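(* Let $A=(A_1,\dots,A_n)$, $n\ge 2$, be real $3\times 4$ matrices of rank $3$ and suppose that their $n$ focal points are in general position in $\mathbb{P}^3$ (all distinct, no three on a line, no four on a plane). Then the rigid multiview variety $V(J_A)\subset(\mathbb{P}^2)^n\times(\mathbb{P}^2)^n$ is cut out as a subset of $V_A\times V_A$ by the $9\binom{n}{2}^2$ octic generators of degree class $(220..220..)$. In other words, equations coming from any two pairs of cameras suffice set-theoretically. Here the relevant octic polynomials are $$T\bigl(\widetilde{\wedge}_5 B_{i_1}^{j_1k_1},\ \widetilde{\wedge}_5 B_{i_2}^{j_1k_1},\ \widetilde{\wedge}_5 C_{i_3}^{j_2k_2},\ \widetilde{\wedge}_5 C_{i_4}^{j_2k_2}\bigr)$$ for all possible choices of indices (camera pairs $\{j_1,k_1\}$ and $\{j_2,k_2\}$, and row indices $i_1,i_2,i_3,i_4\in\{1,\dots,6\}$). Writing $H_A$ for the ideal they generate in $\mathbb{R}[u,v]$, and $I_A(u)+I_A(v)$ for the prime ideal of $V_A\times V_A$, the assertion is that the radical of $H_A+I_A(u)+I_A(v)$ equals $J_A$.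
   Context: A camera is a real $3\times4$ matrix $A_j$ of rank $3$, viewed as a rational map $\mathbb{P}^3\dashrightarrow\mathbb{P}^2$; its focal point is $f_j=\ker A_j\in\mathbb{P}^3$. Varieties are considered over $\mathbb{C}$ (with defining data over $\mathbb{R}$). The multiview variety $V_A\subset(\mathbb{P}^2)^n$ is the Zariski closure of the image of $\mathbb{P}^3\dashrightarrow(\mathbb{P}^2)^n$, $X\mapsto(A_1X,\dots,A_nX)$. Its prime ideal, written in the variables $u$ or $v$ below, is $I_A(u)$ or $I_A(v)$. Let $$Q(X,Y)=(X_0Y_3-Y_0X_3)^2+(X_1Y_3-Y_1X_3)^2+(X_2Y_3-Y_2X_3)^2-X_3^2Y_3^2,$$ bihomogeneous of degree $(2,2)$, defining a hypersurface $V(Q)\subset\mathbb{P}^3\times\mathbb{P}^3$. Let $T$ be the quadrilinear form in $\mathrm{Sym}_2(\mathbb{R}^4)\otimes\mathrm{Sym}_2(\mathbb{R}^4)$ (symmetric in its first two and in its last two arguments) with $Q(X,Y)=T(X,X,Y,Y)$. The rigid multiview variety is the Zariski closure of the image of the rational map $V(Q)\dashrightarrow(\mathbb{P}^2)^n\times(\mathbb{P}^2)^n$, $(X,Y)\mapsto\bigl((A_1X,\dots,A_nX),(A_1Y,\dots,A_nY)\bigr)$. Its multihomogeneous prime ideal in $\mathbb{R}[u,v]=\mathbb{R}[u_{i0},u_{i1},u_{i2},v_{i0},v_{i1},v_{i2}:1\le i\le n]$ is $J_A$. Here $u_i=(u_{i0},u_{i1},u_{i2})^\top$ and $v_i=(v_{i0},v_{i1},v_{i2})^\top$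 are coordinates on the $i$-th factor $\mathbb{P}^2$ on the left, respectively right. For a pair of cameras $j<k$ define the $6\times6$ matrices $$B^{jk}=\begin{bmatrix} A_j & u_j & 0 \\ A_k & 0 & u_k \end{bmatrix},\qquad C^{jk}=\begin{bmatrix} A_j & v_j & 0 \\ A_k & 0 & v_k \end{bmatrix}.$$ $B^{jk}_i$ and $C^{jk}_i$ denote the $5\times6$ matrices obtained by deleting the $i$-th row. For a $5\times 6$ matrix $M$, $\wedge_5M$ is the vector of length $6$ of signed maximal minors (so $M\cdot\wedge_5M=0$), and $\widetilde{\wedge}_5M$ is the vector of its first four entries. Degree class $(220..220..)$ means: degree $2$ in each of $u_{j_1},u_{k_1},v_{j_2},v_{k_2}$ for some pairs $\{j_1,k_1\}$ and $\{j_2,k_2\}$ of cameras, and degree $0$ in all other $u_i,v_i$. The count is nine for each choice of two pairs: for $n=2$ and generic cameras, the octics above span a space whose image modulo the degree $(2,2,2,2)$ component of $I_A(u)+I_A(v)$ has dimension $9$, and $J_A$ has nine minimal generators of that degree. *)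

(* Defs.v *)
From mathcomp Require Import all_boot all_order all_algebra.
From mathcomp Require Import reals complex mpoly ring.
Set Implicit Arguments.
Unset Strict Implicit.
Unset Printing Implicit Defensive.
Import Order.TTheory GRing.Theory Num.Theory.
Local Open Scope ring_scope.

(* A point of (P^2)^m is represented by an m x 3 matrix over R[i] whose rows  *)
(* are nonzero; (P^2)^n x (P^2)^n is the case m = n + n, with the             *)
(* representative col_mx u v.  The coordinate ring {mpoly R[m * 3]} has one   *)
(* variable for each entry, numbered by mxvec_index.                          *)

Section MultiProj.
Variables (R : realType) (m : nat).

Definition is_multipoint (w : 'M[R[i]]_(m, 3)) : Prop :=
  forall i, row i w != 0.

Definition ceval (p : {mpoly R[i][m * 3]}) (w : 'M[R[i]]_(m, 3)) : R[i] :=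
  p.@[fun k => mxvec w 0 k].

Definition reval (p : {mpoly R[m * 3]}) (w : 'M[R[i]]_(m, 3)) : R[i] :=
  ceval (map_mpoly (real_complex R) p) w.

(* Used below for sets S of multipoints closed under rescaling of each row.   *)
(* The polynomials vanishing on such an S form a multihomogeneous ideal, so   *)
(* that it makes no difference whether p is required to be multihomogeneous.  *)
Definition zariski_closure (S : 'M[R[i]]_(m, 3) -> Prop)
    (w : 'M[R[i]]_(m, 3)) : Prop :=
  is_multipoint w /\
  forall p : {mpoly R[i][m * 3]},
    (forall w', S w' -> ceval p w' = 0) -> ceval p w = 0.

Definition vanishing_ideal (S : 'M[R[i]]_(m, 3) -> Prop)
    (p : {mpoly R[m * 3]}) : Prop :=
  forall w, S w -> reval p w = 0.

Definition zero_locus (I : {mpoly R[m * 3]} -> Prop)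
    (w : 'M[R[i]]_(m, 3)) : Prop :=
  is_multipoint w /\ forall p, I p -> reval p w = 0.

End MultiProj.

Section Ideals.
Variables (K : fieldType) (N : nat).
Notation S := {mpoly K[N]}.

Definition ideal_gen (G : S -> Prop) (p : S) : Prop :=
  exists (d : nat) (c g : 'I_d -> S),
    (forall i, G (g i)) /\ p = \sum_(i < d) c i * g i.

Definition ideal_add (I J : S -> Prop) (p : S) : Prop :=
  exists a b, [/\ I a, J b & p = a + b].

Definition ideal_radical (I : S -> Prop) (p : S) : Prop :=
  exists d : nat, I (p ^+ d).

Definition linear_span (G : S -> Prop) (p : S) : Prop :=
  exists (d : nat) (c : 'I_d -> K) (g : 'I_d -> S),
    (forall i, G (g i)) /\ p = \sum_(i < d) c i *: g i.

(* The image in S / I of the K-linear span of G has dimension d: some d       *)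
(* elements of the span map to a basis of that image.                         *)
Definition span_dim_mod (I G : S -> Prop) (d : nat) : Prop :=
  exists b : 'I_d -> S,
    [/\ forall i, linear_span G (b i),
        forall c : 'I_d -> K,
          I (\sum_(i < d) c i *: b i) -> forall i, c i = 0
      & forall g, G g ->
          exists c : 'I_d -> K, I (g - \sum_(i < d) c i *: b i)].

End Ideals.

(* The constraint |X - Y| = 1 and its polarization.                           *)
Section Forms.

Definition hom (S : comUnitRingType) (X : 'cV[S]_4) : S := X ord_max 0.
Definition aff (S : comUnitRingType) (X : 'cV[S]_4) (i : 'I_3) : S :=
  X (lift ord_max i) 0.

Definition Qform (S : comUnitRingType) (X Y : 'cV[S]_4) : S :=
  \sum_(i < 3) (aff X i * hom Y - aff Y i * hom X) ^+ 2
  - hom X ^+ 2 * hom Y ^+ 2.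

(* The unique form linear in each argument, symmetric in (X, X') and in       *)
(* (Y, Y'), that restricts to Qform on the diagonal (lemmas below).           *)
Definition Tform (S : comUnitRingType) (X X' Y Y' : 'cV[S]_4) : S :=
  \sum_(i < 3)
    (aff X i * aff X' i * (hom Y * hom Y')
     + hom X * hom X' * (aff Y i * aff Y' i)
     - 2^-1 * (aff X i * hom X' + hom X * aff X' i)
            * (aff Y i * hom Y' + hom Y * aff Y' i))
  - hom X * hom X' * (hom Y * hom Y').

Lemma Tform_diag (S : comUnitRingType) (X Y : 'cV[S]_4) :
  (2 : S) \is a GRing.unit -> Tform X X Y Y = Qform X Y.
Proof.
move=> u2; rewrite /Tform /Qform; congr (_ - _).
apply: eq_bigr => i _.
set a := aff X i; set b := aff Y i; set c := hom X; set d := hom Y.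
have := mulVr u2; set h := 2^-1 => h2.
have -> : h * (a * c + c * a) * (b * d + d * b)
          = (h * 2) * (2 * (a * b * c * d)) by ring.
by rewrite h2; ring.
Qed.

Lemma Tform_symX (S : comUnitRingType) (X X' Y Y' : 'cV[S]_4) :
  Tform X X' Y Y' = Tform X' X Y Y'.
Proof.
rewrite /Tform; move: (2^-1 : S) => h.
by congr (_ - _); [apply: eq_bigr => i _|]; ring.
Qed.

Lemma Tform_swap (S : comUnitRingType) (X X' Y Y' : 'cV[S]_4) :
  Tform X X' Y Y' = Tform Y Y' X X'.
Proof.
rewrite /Tform; move: (2^-1 : S) => h.
by congr (_ - _); [apply: eq_bigr => i _|]; ring.
Qed.

Lemma Tform_linear (S : comUnitRingType) (a : S) (X1 X2 X' Y Y' : 'cV[S]_4) :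
  Tform (a *: X1 + X2) X' Y Y' = a * Tform X1 X' Y Y' + Tform X2 X' Y Y'.
Proof.
rewrite /Tform; move: (2^-1 : S) => h.
rewrite mulrBr mulr_sumr addrACA -big_split /= -opprD.
congr (_ - _); last by rewrite /hom !mxE; ring.
by apply: eq_bigr => i _; rewrite /hom /aff !mxE; ring.
Qed.

Definition wedge5 (S : comPzRingType) (M : 'M[S]_(5, 6)) : 'cV[S]_6 :=
  \col_(k < 6) ((-1) ^+ k * \det (col' k M : 'M[S]_5)).

Definition wedge5_4 (S : comPzRingType) (M : 'M[S]_(5, 6)) : 'cV[S]_4 :=
  usubmx (wedge5 M : 'cV[S]_(4 + 2)).

Lemma mulmx_wedge5 (S : comPzRingType) (M : 'M[S]_(5, 6)) : M *m wedge5 M = 0.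
Proof.
apply/matrixP => i j; rewrite !mxE.
pose N : 'M[S]_(1 + 5) := col_mx (row i M) M.
have N0 : \det N = 0.
  apply: (determinant_alternate (i1 := lshift 5 0) (i2 := rshift 1 i)) => // k.
  by rewrite col_mxEu col_mxEd mxE.
rewrite -[RHS]N0 (expand_det_row N (lshift 5 0)); apply: eq_bigr => k _.
rewrite {1}/N col_mxEu !mxE /cofactor add0n.
congr (_ * (_ * \det _)); apply/matrixP => r c; rewrite [LHS]mxE 2![RHS]mxE.
have -> : lift (lshift 5 (0 : 'I_1)) r = rshift 1 r by apply: val_inj.
by rewrite /N col_mxEd.
Qed.

End Forms.

Section Cameras.
Variables (R : realType) (n : nat) (A : 'I_n -> 'M[R]_(3, 4)).

(* The one-dimensional row space of focal i is ker (A i), transposed.         *)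
Definition focal (i : 'I_n) : 'M[R]_4 := kermx (A i)^T.

Definition general_position : Prop :=
  [/\ forall i j, i != j -> ~~ (focal i == focal j)%MS,
      forall i j k, uniq [:: i; j; k] ->
        forall L : 'M[R]_4, \rank L = 2%N ->
          ~~ [&& (focal i <= L)%MS, (focal j <= L)%MS & (focal k <= L)%MS]
    & forall i j k l, uniq [:: i; j; k; l] ->
        forall P : 'M[R]_4, \rank P = 3%N ->
          ~~ [&& (focal i <= P)%MS, (focal j <= P)%MS, (focal k <= P)%MS
               & (focal l <= P)%MS]].

Definition picture (i : 'I_n) (X : 'cV[R[i]]_4) : 'rV[R[i]]_3 :=
  (map_mx (real_complex R) (A i) *m X)^T.

(* u represents the image of the point X of P^3, X being in the domain of all *)
(* the maps A i.                                                              *)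
Definition pictures_of (X : 'cV[R[i]]_4) (u : 'M[R[i]]_(n, 3)) : Prop :=
  forall i, picture i X != 0 /\
            exists2 a : R[i], a != 0 & row i u = a *: picture i X.

Definition multiview_variety : 'M[R[i]]_(n, 3) -> Prop :=
  zariski_closure (fun u => exists2 X, X != 0 & pictures_of X u).

Definition multiview_ideal : {mpoly R[n * 3]} -> Prop :=
  vanishing_ideal multiview_variety.

Definition rigid_variety : 'M[R[i]]_(n + n, 3) -> Prop :=
  zariski_closure (fun w => exists X Y,
    [/\ X != 0, Y != 0, Qform X Y = 0,
        pictures_of X (usubmx w) & pictures_of Y (dsubmx w)]).

Definition rigid_ideal : {mpoly R[(n + n) * 3]} -> Prop :=
  vanishing_ideal rigid_variety.

Notation Ruv := {mpoly R[(n + n) * 3]}.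

Definition uvars : 'M[Ruv]_(n, 3) :=
  \matrix_(i, a) 'X_(mxvec_index (lshift n i) a).
Definition vvars : 'M[Ruv]_(n, 3) :=
  \matrix_(i, a) 'X_(mxvec_index (rshift n i) a).

(* The extension to R[u,v] of the ideal of the multiview variety, written in  *)
(* the variables x; it is I_A(u) for x = uvars and I_A(v) for x = vvars.      *)
Definition multiview_ideal_in (x : 'M[Ruv]_(n, 3)) : Ruv -> Prop :=
  ideal_gen (fun p => exists2 f, multiview_ideal f
                      & p = f \mPo [tuple mxvec x 0 k | k < n * 3]).

Definition product_ideal : Ruv -> Prop :=
  ideal_add (multiview_ideal_in uvars) (multiview_ideal_in vvars).

(* B^jk for x = uvars and C^jk for x = vvars.                                 *)
Definition pair_mx (x : 'M[Ruv]_(n, 3)) (j k : 'I_n) : 'M[Ruv]_6 :=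
  let cst : 'M[R]_(3, 4) -> 'M[Ruv]_(3, 4) := map_mx (@mpolyC _ R) in
  col_mx (row_mx (cst (A j)) (row_mx (row j x)^T (0 : 'cV_3)))
         (row_mx (cst (A k)) (row_mx (0 : 'cV_3) (row k x)^T)).

Definition octic (j1 k1 j2 k2 : 'I_n) (i1 i2 i3 i4 : 'I_6) : Ruv :=
  Tform (wedge5_4 (row' i1 (pair_mx uvars j1 k1)))
        (wedge5_4 (row' i2 (pair_mx uvars j1 k1)))
        (wedge5_4 (row' i3 (pair_mx vvars j2 k2)))
        (wedge5_4 (row' i4 (pair_mx vvars j2 k2))).

Definition is_octic (p : Ruv) : Prop :=
  exists (j1 k1 j2 k2 : 'I_n) (i1 i2 i3 i4 : 'I_6),
    [/\ (j1 < k1)%N, (j2 < k2)%N & p = octic j1 k1 j2 k2 i1 i2 i3 i4].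

Definition octic_ideal : Ruv -> Prop := ideal_gen is_octic.

End Cameras.

(* Main.v *)
(* The equalities of zero sets and ideals reduce, by the Nullstellensatz, to  *)
(* this: if u and v satisfy the affine equations of V_A and the octics, then  *)
(* every p in J_A vanishes at (u, v), even when some rows of u or v are 0.    *)
(* The equations of V_A give X and Y with A_j X in <u_j> and A_j Y in <v_j>   *)
(* whenever u_j, v_j are nonzero, and the octics allow one to choose them     *)
(* with Q(X, Y) = 0.  If X and Y are not focal points, (u, v) is a degenerate *)
(* rescaling of their pictures.  If X is a focal point f_j then u_j is        *)
(* arbitrary, and (u, v) is a limit of pictures of X + t om and Y + s ze with *)
(* Q(X + t om, Y + s ze) = 0 and t nonzero: f_j is real, hence Q(f_j, .) is   *)
(* not identically 0, and so t is regular modulo Q(X + t om, Y + s ze).       *)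
(* For the count, det B^jk = 0 on V_A makes \adj B^jk kill the columns of     *)
(* [A_j; A_k], so that modulo I_A only a 2-dimensional space of columns of    *)
(* \adj B^jk remains, and Sym_2 of it has dimension 3 on each side.           *)
Require Import Defs.
From mathcomp Require Import all_boot all_order all_algebra.
From mathcomp Require Import boolp classical_sets reals complex mpoly ring lra.
Set Implicit Arguments.
Unset Strict Implicit.
Unset Printing Implicit Defensive.
Import Order.TTheory GRing.Theory Num.Theory.
Local Open Scope ring_scope.

(** The core is a pointwise statement, [rigid_zeros], about matrices [u] and [v] with zero rows
    allowed. If the multiview equations hold, vanishing minors give points X and Y whose pictures
    lie on the lines spanned by the nonzero rows ([multiview_point]). The admissible X form a linear
    space, [cone_over u]. If it contains a line of P^3, a quadratic equation in one unknown has a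
    root on it and gives Q(X, Y) = 0. If it is a single point, two cameras already determine it
    ([cone_over_rank1]), and one of the truncated wedges of their matrix is a nonzero multiple of X
    ([pair_wedge]). When both sides are single points, some octic is therefore a nonzero multiple of
    Q(X, Y). One pair of cameras per side is enough.

    Once Q(X, Y) = 0, each p in J_A must be shown to vanish at (u, v), although (u, v) may be
    degenerate ([rigid_ideal_vanishes]). Zero scaling factors are removed by density of generic
    parameters ([polyfun_generic]). Focal points are reached as limits along the curve Q(X + t om, Y
    + s ze) = 0 ([rigid_ideal_limit]); the factor t can be cancelled there because focal points are
    real ([Qform_real_nondeg]).

    The radical identity then follows from a Nullstellensatz, proved for uncountable algebraically
    closed fields and descended to real coefficients ([real_nullstellensatz]). Conversely, the
    octics lie in J_A because every wedge formed from pictures of X is a multiple of X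
    ([octic_rigid]).

    For the count, the wedges of a pair of cameras span a plane modulo the determinant of its
    matrix, so 3 * 3 products remain for two pairs ([octic_mod_basis]). They are independent: at
    pictures taken by the two pairs only, a relation becomes Q(X, Y) times a biquadratic form in
    freely varying coordinates ([basis_octic_free]). *)

Section Uncountability.
Variable R : realType.

(** * Uncountability of the real and complex numbers *)

Lemma subinterval_avoiding (s : seq R) (a b : R) : a < b ->
  exists ab : R * R, [/\ a <= ab.1, ab.1 < ab.2, ab.2 <= b
    & forall y, y \in s -> ~~ (ab.1 <= y <= ab.2)].
Proof.
elim: s a b => [|y s IH] a b ltab; first by exists (a, b).
have [[a' b'] /= [lea lt' leb Hs]] := IH a b ltab.
pose m := (a' + b') / 2.
have [ltym|leym] := ltP y m.
  exists (m, b') => /=; rewrite /m in ltym *; split; [lra|lra|lra|].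
  move=> z; rewrite inE => /orP[/eqP->|/Hs]; first by apply/negP; lra.
  by apply: contra => /andP[h1 h2]; apply/andP; split; lra.
exists (a', (a' + m) / 2) => /=; rewrite /m in leym *; split; [lra|lra|lra|].
move=> z; rewrite inE => /orP[/eqP->|/Hs]; first by apply/negP; lra.
by apply: contra => /andP[h1 h2]; apply/andP; split; lra.
Qed.

(** Nested closed intervals: step d passes to a subinterval that misses the finitely many values
    [F d]. The supremum of the left ends lies in all of them. *)
Lemma real_uncountable (F : nat -> seq R) : exists x, forall d, x \notin F d.
Proof.
have /choice[f Hf] : forall dab : nat * (R * R), exists ab : R * R,
    dab.2.1 < dab.2.2 ->
    [/\ dab.2.1 <= ab.1, ab.1 < ab.2, ab.2 <= dab.2.2
      & forall y, y \in F dab.1 -> ~~ (ab.1 <= y <= ab.2)].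
  move=> [d [a b]] /=.
  have [/(subinterval_avoiding (F d))[ab Hab]|nlt] := boolP (a < b); last first.
    by exists (a, b).
  by exists ab.
pose I := fix I d := if d is d'.+1 then f (d', I d') else (0, 1) : R * R.
have Ilt d : (I d).1 < (I d).2.
  by elim: d => [|d IH] /=; [exact: ltr01|have [] := Hf (d, I d) IH].
have Istep d : (I d).1 <= (I d.+1).1 /\ (I d.+1).2 <= (I d).2.
  by have [] := Hf (d, I d) (Ilt d).
have Imon d k : (I d).1 <= (I (d + k)%N).1 /\ (I (d + k)%N).2 <= (I d).2.
  elim: k => [|k [IH1 IH2]]; first by rewrite addn0.
  rewrite addnS; have [h1 h2] := Istep (d + k)%N.
  by split; [exact: le_trans IH1 h1|exact: le_trans h2 IH2].
have Icross d e : (I d).1 <= (I e).2.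
  apply: le_trans (proj1 (Imon d e)) _; apply: le_trans (ltW (Ilt _)) _.
  by rewrite addnC; case: (Imon e d).
pose E : set R := fun x => exists d, x = (I d).1.
have ubE e : ubound E (I e).2 by move=> _ [d ->].
have hE : has_ubound E by exists (I 0%N).2.
exists (sup E) => d; apply/negP => inF.
have [_ _ _ /(_ _ inF)/negP] := Hf (d, I d) (Ilt d); apply.
apply/andP; split; first by apply: ub_le_sup => //; exists d.+1.
by apply: ge_sup; [exists (I 0%N).1, 0%N|exact: (ubE d.+1)].
Qed.

Lemma complex_uncountable (T : countType) (F : T -> seq R[i]) :
  exists x, forall t, x \notin F t.
Proof.
have [x Hx] := real_uncountable (fun n =>
  if unpickle n is Some t then map (@complex.Re R) (F t) else [::]).
exists (real_complex R x) => t; have := Hx (pickle t); rewrite pickleK.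
by apply: contra => xF; apply/mapP; exists (real_complex R x).
Qed.

End Uncountability.

(** The form that the Nullstellensatz uses: countably many finite lists, indexed there by an
    exponent and a degree bound, cannot exhaust K. *)
Definition uncountable_type (K : eqType) :=
  forall (T : countType) (F : T -> seq K), exists x, forall t, x \notin F t.

(** * Ideals as predicates, and congruences modulo them *)

Section Ideal.
Variable S : comNzRingType.
Implicit Types (I : S -> Prop) (p q f : S).

Definition is_ideal I := [/\ I 0, forall a b, I a -> I b -> I (a + b)
  & forall c a, I a -> I (c * a)].

Variables (I : S -> Prop) (idI : is_ideal I).

Lemma idealD a b : I a -> I b -> I (a + b). Proof. by case: idI => _ h _; exact: h. Qed.
Lemma idealMl c a : I a -> I (c * a). Proof. by case: idI => _ _ h; exact: h. Qed.
Lemma idealMr c a : I a -> I (a * c). Proof. by rewrite mulrC; exact: idealMl. Qed.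
Lemma idealN a : I a -> I (- a). Proof. by rewrite -mulN1r; exact: idealMl. Qed.
Lemma idealB a b : I a -> I b -> I (a - b).
Proof. by move=> Ia Ib; apply: idealD => //; exact: idealN. Qed.

Lemma ideal_sum (T : Type) (r : seq T) (P : pred T) (F : T -> S) :
  (forall i, P i -> I (F i)) -> I (\sum_(i <- r | P i) F i).
Proof. by move=> h; apply: (big_ind I); [case: idI|exact: idealD|]. Qed.

Lemma ideal_congM a b c d : I (a - b) -> I (c - d) -> I (a * c - b * d).
Proof.
move=> Iab Icd; have -> : a * c - b * d = (a - b) * c + b * (c - d) by ring.
by apply: idealD; [exact: idealMr|exact: idealMl].
Qed.

Lemma ideal_cong_trans b a c : I (a - b) -> I (b - c) -> I (a - c).
Proof. by move=> Iab Ibc; rewrite -(subrKA b); exact: idealD. Qed.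

Lemma ideal_cong_prod (T : Type) (r : seq T) (P : pred T) (F G : T -> S) :
  (forall i, P i -> I (F i - G i)) ->
  I (\prod_(i <- r | P i) F i - \prod_(i <- r | P i) G i).
Proof.
move=> h; apply: (big_ind2 (fun a b => I (a - b))) => //.
  by rewrite subrr; case: idI.
by move=> *; exact: ideal_congM.
Qed.

Definition ideal_adjoin f p := exists2 h, I h & exists q, p = h + q * f.

Lemma ideal_adjoin_ideal f : is_ideal (ideal_adjoin f).
Proof.
split.
- by exists 0; [case: idI|exists 0; rewrite mul0r addr0].
- move=> _ _ [h Ih [q ->]] [k Ik [r ->]]; exists (h + k); first exact: idealD.
  by exists (q + r); ring.
- move=> c _ [h Ih [q ->]]; exists (c * h); first exact: idealMl.
  by exists (c * q); ring.
Qed.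

Lemma ideal_adjoin_sub f p : I p -> ideal_adjoin f p.
Proof. by exists p => //; exists 0; rewrite mul0r addr0. Qed.

Lemma ideal_adjoin_gen f : ideal_adjoin f f.
Proof. by exists 0; [case: idI|exists 1; rewrite add0r mul1r]. Qed.

End Ideal.

Lemma mpoly_congr (K : comNzRingType) (N M : nat) (J : {mpoly K[M]} -> Prop)
    (s t : N.-tuple {mpoly K[M]}) (f : {mpoly K[N]}) :
  is_ideal J -> (forall k, J (tnth s k - tnth t k)) ->
  J ((f \mPo s) - (f \mPo t)).
Proof.
move=> idJ st; rewrite !comp_mpolyE -sumrB; apply: ideal_sum => // m _.
rewrite -scalerBr -mul_mpolyC; apply: idealMl => //.
apply: ideal_cong_prod => // i _; elim: (m i) => [|e IH].
  by rewrite !expr0 subrr; case: idJ.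
by rewrite !exprS; exact: ideal_congM.
Qed.

Lemma comp_mpoly_const (K : comNzRingType) (N : nat) (b : 'I_N -> K)
    (f : {mpoly K[N]}) : f \mPo [tuple (b k)%:MP_[N] | k < N] = (f.@[b])%:MP.
Proof.
rewrite comp_mpolyE mevalE rmorph_sum; apply: eq_bigr => m _ /=.
rewrite mpolyCM -mul_mpolyC rmorph_prod; congr (_ * _).
by apply: eq_bigr => i _; rewrite tnth_mktuple /= rmorphXn.
Qed.

(** * Nullstellensatz over an uncountable algebraically closed field *)

Section Nullstellensatz.
Variables (K : closedFieldType) (N : nat).
Hypothesis uncK : uncountable_type K.
Notation S := {mpoly K[N]}.
Implicit Types (I : S -> Prop) (p q f : S).

Lemma infinite_or_listed (P : K -> Prop) :
  (exists s : seq K, forall x, P x -> x \in s) \/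
  (forall n, exists s : n.-tuple K, uniq s /\ forall x, x \in s -> P x).
Proof.
have [|nl] := pselect (exists s : seq K, forall x, P x -> x \in s); first by left.
right; elim=> [|n [s [us Ps]]]; first by exists [tuple].
have [x [Px xs]] : exists x, P x /\ x \notin s.
  apply: contrapT => h; apply: nl; exists s => x Px.
  by apply: contrapT => /negP xs; apply: h; exists x.
exists [tuple of x :: s]; split; first by rewrite /= xs.
by move=> y; rewrite inE => /orP[/eqP->|/Ps].
Qed.

(** The family has one member more than there are monomials of degree below m, so its coefficient
    matrix has a nonzero left kernel vector. *)
Lemma bounded_dependent (m : nat) (q : 'I_(#|{: 'X_{1..N < m}}|).+1 -> S) :
  (forall i, msize (q i) <= m)%N ->
  exists2 c : 'I_(#|{: 'X_{1..N < m}}|).+1 -> K,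
    exists i, c i != 0 & \sum_i c i *: q i = 0.
Proof.
set D := #|_| in q *; move=> qm.
pose mon (j : 'I_D) : 'X_{1..N < m} := enum_val j.
pose Q : 'M[K]_(D.+1, D) := \matrix_(i, j) (q i)@_(mon j).
have : kermx Q != 0.
  rewrite -mxrank_eq0 mxrank_ker -lt0n subn_gt0 ltnS.
  exact: rank_leq_col.
case/rowV0Pn => c /sub_kermxP cQ /rV0Pn[i ci].
exists (fun i => c 0 i); first by exists i.
apply/mpolyP => mm; rewrite mcoeff0 raddf_sum /=.
have [mlt|mge] := ltnP (mdeg mm) m; last first.
  apply: big1 => j _; rewrite mcoeffZ memN_msupp_eq0 ?mulr0 //.
  by apply: msize_mdeg_ge; exact: leq_trans (qm j) mge.
have := congr1 (fun M : 'rV_D => M 0 (enum_rank (BMultinom mlt))) cQ.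
rewrite !mxE => EQ; apply: etrans EQ; apply: eq_bigr => j _.
by rewrite mcoeffZ mxE /mon enum_rankK.
Qed.

(** The localization at p of the quotient by I is nonzero. The case d = 0 says that I is proper. *)
Definition saturated_proper I p := forall d : nat, ~ I (p ^+ d).

(* If no point works, every X_k - a has an inverse q_a / p^d modulo I; since  *)
(* K is uncountable, infinitely many q_a have the same d and bounded degree,  *)
(* hence are linearly dependent, which makes p^d f(X_k) vanish modulo I for   *)
(* some nonzero univariate f, and f is a product of invertible factors.       *)
Lemma adjoin_value I p (k : 'I_N) : is_ideal I -> saturated_proper I p ->
  exists a, saturated_proper (ideal_adjoin I ('X_k - a%:MP)) p.
Proof.
move=> idI prop; apply: contrapT => nex.
have inv a : exists dq : nat * S, I (p ^+ dq.1 - dq.2 * ('X_k - a%:MP)).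
  apply: contrapT => h; apply: nex; exists a => d [g Ig [q E]].
  by apply: h; exists (d, q); rewrite /= E addrK.
pose P (dm : nat * nat) a :=
  exists2 q : S, I (p ^+ dm.1 - q * ('X_k - a%:MP)) & (msize q <= dm.2)%N.
have [dm infP] : exists dm, forall n, exists s : n.-tuple K,
    uniq s /\ forall x, x \in s -> P dm x.
  apply: contrapT => h.
  have /choice[F HF] : forall dm, exists s : seq K, forall x, P dm x -> x \in s.
    move=> dm; have [//|inf] := infinite_or_listed (P dm).
    by case: h; exists dm.
  have [x Hx] := uncK F; have [[d q] /= Iq] := inv x.
  by have /negP := Hx (d, msize q); apply; apply: HF; exists q.
case: dm infP => d m infP.
have [s [us Ps]] := infP (#|{: 'X_{1..N < m}}|).+1.
have /choice[q Hq] : forall i, exists q : S,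
    I (p ^+ d - q * ('X_k - (tnth s i)%:MP)) /\ (msize q <= m)%N.
  by move=> i; have [q Iq qm] := Ps _ (mem_tnth i s); exists q.
have [c [i0 ci0] cq] := bounded_dependent (fun i => proj2 (Hq i)).
(* The numerator of the sum of the fractions c_i / (X - s_i). At the node s_i0 only the summand i0
   survives, so f is nonzero. *)
pose f : {poly K} :=
  \sum_i c i *: \prod_(j | j != i) ('X - (tnth s j)%:P).
have f0 : f != 0.
  have fi0 : f.[tnth s i0]
      = c i0 * \prod_(j | j != i0) (tnth s i0 - tnth s j).
    rewrite /f horner_sum; apply: etrans (bigD1 i0 _) _ => //=.
    rewrite [X in _ + X]big1 => [|i ii0].
      rewrite addr0 hornerZ horner_prod; congr (_ * _).
      by apply: eq_bigr => j _; rewrite hornerXsubC.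
    rewrite hornerZ horner_prod (bigD1 i0) 1?eq_sym //=.
    by rewrite hornerXsubC subrr mul0r mulr0.
  apply/negP => /eqP f0; move: fi0; rewrite f0 horner0 => /esym/eqP.
  rewrite mulf_eq0 (negPf ci0) /=; apply/negP/prodf_neq0 => j.
  by apply: contra; rewrite subr_eq0 => /eqP/tuple_uniqP ->.
pose phi := horner_alg ('X_k : S).
have phiX b : phi ('X - b%:P) = 'X_k - b%:MP.
  by rewrite /phi rmorphB /= horner_algX horner_algC alg_mpolyC.
have If : I (p ^+ d * phi f).
  rewrite /f /phi raddf_sum mulr_sumr -/phi /=.
  have -> : \sum_i p ^+ d * phi (c i *: \prod_(j | j != i) ('X - (tnth s j)%:P))
     = \sum_i (c i)%:MP * ((p ^+ d - q i * ('X_k - (tnth s i)%:MP))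
          * \prod_(j | j != i) ('X_k - (tnth s j)%:MP))
     + (\sum_i c i *: q i) * \prod_j ('X_k - (tnth s j)%:MP).
    rewrite mulr_suml -big_split; apply: eq_bigr => i _ /=.
    rewrite /phi linearZ /= rmorph_prod -/phi (eq_bigr _ (fun j _ => phiX (tnth s j))).
    rewrite [X in _ = _ + _ * X](bigD1 i) //= -!mul_mpolyC.
    by move: (\prod_(j | _) _) => P0; ring.
  rewrite cq mul0r addr0; apply: ideal_sum => // i _.
  by apply: idealMl => //; apply: idealMr => //; case: (Hq i).
have [r Er] := closed_field_poly_normal f.
rewrite Er in If.
have {If} : I (p ^+ d * \prod_(b <- r) ('X_k - b%:MP)).
  move: If; rewrite /phi linearZ /= rmorph_prod -/phi => If.
  rewrite (eq_bigr _ (fun b _ => phiX b)) -mul_mpolyC in If.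
  have {}If := idealMl idI ((lead_coef f)^-1)%:MP If.
  rewrite mulr1 mulrCA [X in I (_ * X)]mulrA -mpolyCM in If.
  by rewrite mulVf ?lead_coef_eq0 // mpolyC1 mul1r in If.
(* Each factor X_k - b is removed with its inverse modulo I, at the price of a higher power of p;
   hence d is generalized. *)
elim: r d {Hq infP Ps Er} => [|b r IH] d.
  by rewrite big_nil mulr1; exact: prop.
rewrite big_cons => If; have [[e q'] /= Iq] := inv b.
apply: (IH (e + d)%N); set P0 := \prod_(_ <- r) _ in If *.
have -> : p ^+ (e + d) * P0 =
    (p ^+ e - q' * ('X_k - b%:MP)) * (p ^+ d * P0)
    + q' * (p ^+ d * (('X_k - b%:MP) * P0)) by rewrite exprD; ring.
by apply: idealD => //; [exact: idealMr|exact: idealMl].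
Qed.

(** If no power of p lies in I, adjoining some X_k - b_k for each k in turn keeps it so. In the
    final ideal every f is congruent to f(b). Hence f(b) = 0 for f in I, as 1 is not in the ideal,
    and p(b) is nonzero, as p is not: b contradicts the hypothesis. *)
Lemma nullstellensatz I p : is_ideal I ->
  (forall b : 'I_N -> K, (forall f, I f -> f.@[b] = 0) -> p.@[b] = 0) ->
  exists d : nat, I (p ^+ d).
Proof.
move=> idI van; apply: contrapT => nex.
have prop : saturated_proper I p by move=> d Id; apply: nex; exists d.
have [I' [idI' sub prop' [b Hb]]] : exists I', [/\ is_ideal I',
    forall f, I f -> I' f, saturated_proper I' p
    & exists b : 'I_N -> K, forall k, k \in enum 'I_N -> I' ('X_k - (b k)%:MP)].
  elim: (enum _) => [|k s [I' [idI' sub prop' [b Hb]]]].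
    by exists I; split => //; exists (fun=> 0).
  have [a Ha] := adjoin_value k idI' prop'.
  exists (ideal_adjoin I' ('X_k - a%:MP)); split.
  - exact: ideal_adjoin_ideal.
  - by move=> f /sub; exact: ideal_adjoin_sub.
  - by [].
  - exists (fun j => if j == k then a else b j) => j; rewrite inE.
    have [->|_] := eqVneq j k; first by move=> _; exact: ideal_adjoin_gen.
    by move/Hb; exact: ideal_adjoin_sub.
have cst f : I' (f - (f.@[b])%:MP).
  rewrite -comp_mpoly_const -{1}[f]comp_mpoly_id; apply: mpoly_congr => // k.
  by rewrite !tnth_mktuple; apply: Hb; rewrite mem_enum.
have zero f : I f -> f.@[b] = 0.
  move=> /sub If; apply/eqP/negPn/negP => fb; case: (prop' 0%N).
  have := idealB idI' If (cst f); rewrite opprB addrC subrK expr0 => If'.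
  have := idealMl idI' ((f.@[b])^-1)%:MP If'.
  by rewrite -mpolyCM mulVf // mpolyC1.
by case: (prop' 1%N); rewrite expr1; have := cst p; rewrite van // mpolyC0 subr0.
Qed.

Lemma mpoly_eq0_fun p : (forall b, p.@[b] = 0) -> p = 0.
Proof.
move=> p0; have [||d /eqP] := @nullstellensatz (fun q => q = 0) p.
- split=> // [_ _ -> ->|c _ ->]; [exact: addr0|exact: mulr0].
- by move=> b _; exact: p0.
by rewrite expf_eq0 => /andP[_ /eqP].
Qed.

End Nullstellensatz.


(** * Polynomial functions *)

Section PolynomialFunctions.
Variables (K : comNzRingType) (N : nat).
Implicit Types (f g : ('I_N -> K) -> K).

Definition polyfun f := exists p : {mpoly K[N]}, forall x, f x = p.@[x].

Lemma polyfun_ext f g : f =1 g -> polyfun f -> polyfun g.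
Proof. by move=> fg [p Hp]; exists p => x; rewrite -fg. Qed.

Lemma polyfun_cst c : polyfun (fun=> c).
Proof. by exists c%:MP => x; rewrite mevalC. Qed.

Lemma polyfun_var i : polyfun (fun x => x i).
Proof. by exists 'X_i => x; rewrite mevalXU. Qed.

Lemma polyfunD f g : polyfun f -> polyfun g -> polyfun (fun x => f x + g x).
Proof. by move=> [p Hp] [q Hq]; exists (p + q) => x; rewrite mevalD Hp Hq. Qed.

Lemma polyfunM f g : polyfun f -> polyfun g -> polyfun (fun x => f x * g x).
Proof. by move=> [p Hp] [q Hq]; exists (p * q) => x; rewrite mevalM Hp Hq. Qed.

Lemma polyfunN f : polyfun f -> polyfun (fun x => - f x).
Proof. by move=> [p Hp]; exists (- p) => x; rewrite mevalN Hp. Qed.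

Lemma polyfunB f g : polyfun f -> polyfun g -> polyfun (fun x => f x - g x).
Proof. by move=> Hf Hg; apply: polyfunD => //; exact: polyfunN. Qed.

Lemma polyfunX f d : polyfun f -> polyfun (fun x => f x ^+ d).
Proof. by move=> [p Hp]; exists (p ^+ d) => x; rewrite rmorphXn /= Hp. Qed.

Lemma polyfun_sum (T : Type) (r : seq T) (P : pred T) (F : T -> ('I_N -> K) -> K) :
  (forall i, polyfun (F i)) -> polyfun (fun x => \sum_(i <- r | P i) F i x).
Proof.
move=> /choice[p Hp]; exists (\sum_(i <- r | P i) p i) => x.
by rewrite raddf_sum; apply: eq_bigr => i _; exact: Hp.
Qed.

Lemma polyfun_prod (T : Type) (r : seq T) (P : pred T) (F : T -> ('I_N -> K) -> K) :
  (forall i, polyfun (F i)) -> polyfun (fun x => \prod_(i <- r | P i) F i x).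
Proof.
move=> /choice[p Hp]; exists (\prod_(i <- r | P i) p i) => x.
by rewrite rmorph_prod; apply: eq_bigr => i _; exact: Hp.
Qed.

Lemma polyfun_meval M (p : {mpoly K[M]}) (g : 'I_M -> ('I_N -> K) -> K) :
  (forall k, polyfun (g k)) -> polyfun (fun x => p.@[fun k => g k x]).
Proof.
move=> /choice[q Hq]; exists (p \mPo [tuple q k | k < M]) => x.
by rewrite comp_mpoly_meval; apply: meval_eq => k; rewrite tnth_mktuple Hq.
Qed.

End PolynomialFunctions.

(** * Density of nonvanishing loci, and cancellation of regular variables *)

Section GenericPoints.
Variables (K : closedFieldType) (N : nat).
Hypothesis uncK : uncountable_type K.
Implicit Types (f g : ('I_N -> K) -> K).

Definition nzpolyfun f := polyfun f /\ exists x, f x != 0.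

Lemma nzpolyfunM f g : nzpolyfun f -> nzpolyfun g -> nzpolyfun (fun x => f x * g x).
Proof.
move=> [pf [x fx]] [pg [y gy]]; split; first exact: polyfunM.
have [[p Hp] [q Hq]] := (pf, pg).
apply: contrapT => h; have : p * q = 0.
  apply: (mpoly_eq0_fun uncK) => b; rewrite mevalM -Hp -Hq; apply/eqP/negPn/negP => fg.
  by apply: h; exists b.
move/eqP; rewrite mulf_eq0 => /orP[]/eqP E.
  by move: fx; rewrite Hp E meval0 eqxx.
by move: gy; rewrite Hq E meval0 eqxx.
Qed.

Lemma nzpolyfun_prod (T : Type) (r : seq T) (P : pred T)
    (F : T -> ('I_N -> K) -> K) : (forall i, nzpolyfun (F i)) ->
  nzpolyfun (fun x => \prod_(i <- r | P i) F i x).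
Proof.
move=> HF; split; first by apply: polyfun_prod => i; case: (HF i).
elim: r => [|i r [x Hx]].
  by exists (fun=> 0); rewrite big_nil oner_eq0.
have [y Hy] : exists y, F i y * \prod_(j <- r | P j) F j y != 0.
  have [||_ //] := @nzpolyfunM (F i) (fun y => \prod_(j <- r | P j) F j y) => //.
  by split; [apply: polyfun_prod => j; case: (HF j)|exists x].
exists y; rewrite big_cons; case: ifP => // _.
by move: Hy; rewrite mulf_eq0 negb_or => /andP[].
Qed.

Lemma polyfun_generic f g : polyfun f -> nzpolyfun g ->
  (forall x, g x != 0 -> f x = 0) -> forall x, f x = 0.
Proof.
move=> pf nzg fg x; apply/eqP/negPn/negP => fx.
have [||_ [y]] := @nzpolyfunM f g => //; first by split=> //; exists x.
have [->|gy] := eqVneq (g y) 0; first by rewrite mulr0 eqxx.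
by rewrite fg // mul0r eqxx.
Qed.

(** Setting X_i to 0 kills h * p but not p, since c lies on that hyperplane. So it kills h, that is,
    X_i divides h. *)
Lemma mpoly_dvd_cancelX (p F : {mpoly K[N]}) (i : 'I_N) (c : 'I_N -> K) :
  c i = 0 -> p.@[c] != 0 ->
  (exists h, F * 'X_i = h * p) -> exists h, F = h * p.
Proof.
move=> ci pc [h E].
pose s := [tuple if k == i then 0 else ('X_k : {mpoly K[N]}) | k < N].
have ps : (p \mPo s) != 0.
  apply: contraNneq pc => ps; rewrite -(meval0 c) -ps comp_mpoly_meval.
  apply/eqP/meval_eq => k; rewrite tnth_mktuple.
  by case: eqP => [->|_]; rewrite ?meval0 ?mevalXU.
have hs : h \mPo s = 0.
  have := congr1 (comp_mpoly s) E; rewrite !rmorphM /= comp_mpolyXU.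
  rewrite -tnth_nth tnth_mktuple eqxx mulr0 => /esym/eqP.
  by rewrite mulf_eq0 (negPf ps) orbF => /eqP.
have idX : is_ideal (fun f : {mpoly K[N]} => exists q, f = q * 'X_i).
  split; first by exists 0; rewrite mul0r.
    by move=> _ _ [q ->] [r ->]; exists (q + r); rewrite mulrDl.
  by move=> d _ [q ->]; exists (d * q); rewrite mulrA.
have := mpoly_congr (s := [tuple 'X_k | k < N]) (t := s) h idX.
rewrite comp_mpoly_id hs subr0 => -[k|q Eq].
  rewrite !tnth_mktuple; case: eqP => [->|_].
    by exists 1; rewrite subr0 mul1r.
  by exists 0; rewrite subrr mul0r.
exists q; have X0 : ('X_i : {mpoly K[N]}) != 0.
  by rewrite -msize_poly_eq0 msizeX.
by apply: (mulIf X0); rewrite E Eq; ring.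
Qed.

(* The variables in E are regular modulo p because p does not vanish          *)
(* identically on the hyperplanes x_i = 0.                                    *)
Lemma polyfun_cancel (E : pred 'I_N) (P G : ('I_N -> K) -> K) (b : 'I_N -> K) :
  polyfun P -> polyfun G -> P b = 0 ->
  (forall i, E i -> exists2 c, c i = 0 & P c != 0) ->
  (forall x, P x = 0 -> (forall i, E i -> x i != 0) -> G x = 0) -> G b = 0.
Proof.
move=> [p Hp] [g Hg] Pb HE HG.
have idp : is_ideal (fun f : {mpoly K[N]} => exists q, f = q * p).
  split; first by exists 0; rewrite mul0r.
    by move=> _ _ [q ->] [r ->]; exists (q + r); rewrite mulrDl.
  by move=> d _ [q ->]; exists (d * q); rewrite mulrA.
(* On the zeros of P either some variable of E vanishes or G does, so a power of this product is
   divisible by P. The variables are then cancelled one by one. *)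
have [|d] := nullstellensatz (p := g * \prod_(i | E i) 'X_i) uncK idp.
  move=> x Hx; rewrite mevalM rmorph_prod /=.
  have [/existsP[i /andP[Ei /eqP xi]]|] := boolP [exists i, E i && (x i == 0)].
    by rewrite (bigD1 i) //= mevalXU xi mul0r mulr0.
  rewrite negb_exists => /forallP nx; rewrite -Hg HG ?mul0r //.
    by rewrite Hp; apply: Hx; exists 1; rewrite mul1r.
  by move=> i Ei; have := nx i; rewrite Ei.
rewrite exprMn -prodrXl => H.
have {H} [q Eq] : exists q, g ^+ d = q * p.
  move: H; elim: (index_enum _) => [|i r IH]; first by rewrite big_nil mulr1.
  rewrite big_cons; case: ifP => // Ei.
  have [c ci Pc] := HE i Ei; rewrite Hp in Pc.
  move: (\prod_(_ <- _ | _) _) IH => Pr IH H; apply: IH.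
  move: H; rewrite mulrA mulrAC.
  move: (g ^+ d * Pr) => F.
  elim: d => [|e IH]; first by rewrite mulr1.
  by rewrite exprSr mulrA => /(mpoly_dvd_cancelX ci Pc).
have /eqP := congr1 (meval b) Eq; rewrite rmorphXn /= mevalM -Hp -Hg Pb mulr0.
by rewrite expf_eq0 => /andP[_ /eqP].
Qed.

End GenericPoints.


(** * Pictures of points, and focal points *)

Section Pictures.
Variables (R : realType) (n : nat) (A : 'I_n -> 'M[R]_(3, 4)).
Notation C := R[i].
Local Notation pic := (picture A).
Hypothesis hrank : forall i, \rank (A i) = 3%N.
Hypothesis hpos : general_position A.

Lemma pictureD j (X Y : 'cV[C]_4) : pic j (X + Y) = pic j X + pic j Y.
Proof. by rewrite /picture mulmxDr linearD. Qed.

Lemma pictureZ j t (X : 'cV[C]_4) : pic j (t *: X) = t *: pic j X.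
Proof. by rewrite /picture -scalemxAr linearZ. Qed.

Lemma picture0 j : pic j 0 = 0.
Proof. by rewrite /picture mulmx0 trmx0. Qed.

Lemma picture_neq0 j (X : 'cV[C]_4) : pic j X != 0 -> X != 0.
Proof. by apply: contraNneq => ->; rewrite picture0. Qed.

Lemma picture_tr j (X : 'cV[C]_4) :
  pic j X = X^T *m map_mx (real_complex R) (A j)^T.
Proof. by rewrite /picture trmx_mul map_trmx. Qed.

Lemma picture_surj j (w : 'rV[C]_3) : exists X, pic j X = w.
Proof.
have /row_fullP[B HB] : row_full (map_mx (real_complex R) (A j)^T).
  by rewrite /row_full mxrank_map mxrank_tr hrank.
by exists (w *m B)^T; rewrite picture_tr trmxK -mulmxA HB mulmx1.
Qed.

Lemma rank_focal j : \rank (focal A j) = 1%N.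
Proof. by rewrite /focal mxrank_ker mxrank_tr hrank. Qed.

Lemma picture_eq0 j (X : 'cV[C]_4) :
  (pic j X == 0) = (X^T <= map_mx (real_complex R) (focal A j))%MS.
Proof. by rewrite /focal map_kermx picture_tr; apply/eqP/sub_kermxP. Qed.

(** The kernel of a real matrix of rank 3 has a real basis vector, which still spans the kernel over
    the complex numbers. *)
Lemma focal_real j (X : 'cV[C]_4) : pic j X = 0 ->
  exists (z : 'cV[R]_4) c, X = c *: map_mx (real_complex R) z.
Proof.
move/eqP; rewrite picture_eq0.
have h : (map_mx (real_complex R) (focal A j)
    <= map_mx (real_complex R) (row_base (focal A j)))%MS.
  by rewrite map_submx eq_row_base.
move=> Xj; have := submx_trans Xj h.
case/submxP; move: (row_base _); rewrite rank_focal => z D E.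
exists z^T, (D 0 0); apply: (can_inj trmxK).
by rewrite E [D]mx11_scalar mul_scalar_mx linearZ /= map_trmx trmxK !mxE.
Qed.

(** A nonzero vector killed by both cameras would span both kernels, so the two focal points would
    coincide. *)
Lemma picture_inj2 i j (X : 'cV[C]_4) :
  i != j -> pic i X = 0 -> pic j X = 0 -> X = 0.
Proof.
case: hpos => h _ _ /h {}h /eqP hi /eqP hj; apply/eqP; apply: contraNT h => X0.
have rX : \rank X^T = 1%N by rewrite mxrank_tr; apply/eqP; rewrite eqn_leq lt0n mxrank_eq0 X0 rank_leq_col.
have key k : pic k X == 0 -> (X^T == map_mx (real_complex R) (focal A k))%MS.
  by rewrite picture_eq0 => h; rewrite -(geq_leqif (mxrank_leqif_eq h)) mxrank_map rank_focal rX.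
have [/andP[i1 i2] /andP[j1 j2]] := (key _ hi, key _ hj).
apply/andP; split; rewrite -(map_submx (real_complex R)).
  exact: submx_trans i2 j1.
exact: submx_trans j2 i1.
Qed.

End Pictures.

(** * The form Q at real points *)

Section Quadric.
Variable R : realType.
Notation C := R[i].

Lemma QformZl (c : C) (X Y : 'cV[C]_4) : Qform (c *: X) Y = c ^+ 2 * Qform X Y.
Proof.
rewrite /Qform mulrBr mulr_sumr.
congr (_ - _); last by rewrite /Defs.hom !mxE; ring.
by apply: eq_bigr => i _; rewrite /Defs.hom /aff !mxE; ring.
Qed.

Lemma QformC (S : comUnitRingType) (X Y : 'cV[S]_4) : Qform X Y = Qform Y X.
Proof.
rewrite /Qform; congr (_ - _); last by ring.
by apply: eq_bigr => i _; ring.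
Qed.

(** If the last coordinate h of Z is nonzero, then Q(Z, Z) = - h^4. If Z is at infinity, Q(Z, Y)
    with Y the origin is the sum of the squares of the affine coordinates of Z, nonzero because they
    are real. Isotropic complex points at infinity would be exceptions. *)
Lemma Qform_real_nondeg (c : C) (z : 'cV[R]_4) :
  c *: map_mx (real_complex R) z != 0 ->
  exists Y, Qform (c *: map_mx (real_complex R) z) Y != 0.
Proof.
rewrite scaler_eq0 negb_or => /andP[c0 z0].
set Z := map_mx _ z in z0 *.
suff [Y QY] : exists Y, Qform Z Y != 0.
  by exists Y; rewrite QformZl mulf_neq0 // expf_neq0.
have [h0|h0] := eqVneq (Defs.hom Z) 0; last first.
  exists Z; rewrite /Qform big1 ?sub0r ?oppr_eq0 ?mulf_neq0 ?expf_neq0 //.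
  by move=> i _; rewrite subrr expr0n.
exists (delta_mx ord_max 0); rewrite /Qform h0 expr0n /= mul0r subr0.
have -> : \sum_(i < 3) (aff Z i * Defs.hom (delta_mx ord_max 0)
     - aff (delta_mx ord_max 0) i * 0) ^+ 2
   = real_complex R (\sum_(i < 3) (aff z i) ^+ 2).
  rewrite rmorph_sum; apply: eq_bigr => i _.
  by rewrite mulr0 subr0 rmorphXn /aff /Defs.hom !mxE eqxx mulr1.
rewrite -(rmorph0 (real_complex R)) (inj_eq (@complexI R)).
apply: contra z0; rewrite psumr_eq0 => [/allP h|i _]; last exact: sqr_ge0.
apply/eqP/colP => k; rewrite !mxE.
have [i ->|->] := unliftP ord_max k; last by move: h0; rewrite /Defs.hom mxE.
by have := h i (mem_index_enum _); rewrite sqrf_eq0 => /eqP E; rewrite -/(aff z i) E.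
Qed.

End Quadric.


(** * Matrices with polynomial entries *)

Section PolynomialMatrices.
Variables (R : realType) (N : nat).
Notation C := R[i].

Definition polymx m k (W : ('I_N -> C) -> 'M[C]_(m, k)) :=
  forall i j, polyfun (fun x => W x i j).

Lemma polymx_cst m k (M : 'M[C]_(m, k)) : polymx (fun=> M).
Proof. by move=> i j; exact: polyfun_cst. Qed.

Lemma polymxD m k (V W : ('I_N -> C) -> 'M[C]_(m, k)) :
  polymx V -> polymx W -> polymx (fun x => V x + W x).
Proof.
move=> hV hW i j; apply: (polyfun_ext (f := fun x => V x i j + W x i j)).
  by move=> x; rewrite mxE.
exact: polyfunD.
Qed.

Lemma polymxZ m k f (W : ('I_N -> C) -> 'M[C]_(m, k)) :
  polyfun f -> polymx W -> polymx (fun x => f x *: W x).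
Proof.
move=> hf hW i j; apply: (polyfun_ext (f := fun x => f x * W x i j)).
  by move=> x; rewrite mxE.
exact: polyfunM.
Qed.

Lemma polymx_picture n (A : 'I_n -> 'M[R]_(3, 4)) j (X : ('I_N -> C) -> 'cV[C]_4) :
  polymx X -> polymx (fun x => picture A j (X x)).
Proof.
move=> hX r c; apply: (polyfun_ext (f := fun x =>
    \sum_k map_mx (real_complex R) (A j) c k * X x k r)).
  by move=> x; rewrite ord1 !mxE.
by apply: polyfun_sum => k; apply: polyfunM => //; exact: polyfun_cst.
Qed.

Lemma polymx_if m k (b : bool) (V W : ('I_N -> C) -> 'M[C]_(m, k)) :
  polymx V -> polymx W -> polymx (fun x => if b then V x else W x).
Proof. by case: b. Qed.

Lemma polymx_rows m k (W : 'I_m -> ('I_N -> C) -> 'rV[C]_k) :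
  (forall i, polymx (W i)) -> polymx (fun x => \matrix_i W i x).
Proof.
move=> hW i j; apply: (polyfun_ext (f := fun x => W i x 0 j)); last exact: hW.
by move=> x; rewrite mxE.
Qed.

Lemma polymx_col m1 m2 k (V : ('I_N -> C) -> 'M[C]_(m1, k))
    (W : ('I_N -> C) -> 'M[C]_(m2, k)) :
  polymx V -> polymx W -> polymx (fun x => col_mx (V x) (W x)).
Proof.
move=> hV hW r j; rewrite -[r]splitK; case: (split r) => i' /=.
  by apply: polyfun_ext (hV i' j) => x; rewrite col_mxEu.
by apply: polyfun_ext (hW i' j) => x; rewrite col_mxEd.
Qed.

Lemma polyfun_Qform (X Y : ('I_N -> C) -> 'cV[C]_4) :
  polymx X -> polymx Y -> polyfun (fun x => Qform (X x) (Y x)).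
Proof.
move=> hX hY; rewrite /Qform /aff /Defs.hom; apply: polyfunB.
  apply: polyfun_sum => i; apply: polyfunX.
  by apply: polyfunB; apply: polyfunM; [exact: hX|exact: hY|exact: hY|exact: hX].
by apply: polyfunM; apply: polyfunX; [exact: hX|exact: hY].
Qed.

Lemma polyfun_reval m (p : {mpoly R[m * 3]}) (W : ('I_N -> C) -> 'M[C]_(m, 3)) :
  polymx W -> polyfun (fun x => reval p (W x)).
Proof.
move=> hW; rewrite /reval /ceval; apply: polyfun_meval => k.
case/mxvec_indexP: k => i j; apply: polyfun_ext (hW i j) => x.
by rewrite mxvecE.
Qed.

End PolynomialMatrices.

(** * Limits of pictures of rigid pairs *)

Section RigidIdeal.
Variables (R : realType) (n : nat) (A : 'I_n -> 'M[R]_(3, 4)).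
Notation C := R[i].
Local Notation pic := (picture A).
Hypothesis hn : (2 <= n)%N.
Hypothesis hrank : forall i, \rank (A i) = 3%N.
Hypothesis hpos : general_position A.

Lemma pictures_multipoint (X : 'cV[C]_4) u : pictures_of A X u -> is_multipoint u.
Proof. by move=> h i; have [hp [a a0 ->]] := h i; rewrite scaler_eq0 negb_or a0. Qed.

Lemma rigid_ideal_pictures p (X Y : 'cV[C]_4) u v : rigid_ideal A p ->
  Qform X Y = 0 -> pictures_of A X u -> pictures_of A Y v ->
  reval p (col_mx u v) = 0.
Proof.
move=> hp Q0 hu hv; apply: hp.
have i0 : 'I_n by exact: Ordinal (leq_trans (ltnSn 1) hn).
have nz (Z : 'cV[C]_4) w : pictures_of A Z w -> Z != 0.
  by move=> h; have [/picture_neq0] := h i0.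
split.
  move=> r; rewrite -[r]splitK; case: (split r) => j /=.
    by rewrite rowKu; exact: (pictures_multipoint hu).
  by rewrite rowKd; exact: (pictures_multipoint hv).
by move=> q; apply; exists X, Y; rewrite col_mxKu col_mxKd; split => //;
  [exact: nz hu|exact: nz hv].
Qed.

Definition focal_point (X : 'cV[C]_4) := [exists j, pic j X == 0].

(* The limit for t -> 0 of the pictures of X + t *: om, as points of P^2.     *)
Definition limit_picture (X om : 'cV[C]_4) j :=
  if pic j X == 0 then pic j om else pic j X.

(** When X is the focal point of camera j, the picture of X + t om is t times that of om. Dropping
    this factor keeps the family polynomial in t, with value [limit_picture] at t = 0. *)
Definition moving_picture (X om : 'cV[C]_4) t j :=
  if pic j X == 0 then pic j om else pic j (X + t *: om).

Lemma moving_pictureP X om t j : (focal_point X -> t != 0) ->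
  exists2 a, a != 0 & moving_picture X om t j = a *: pic j (X + t *: om).
Proof.
rewrite /moving_picture => ht; case: eqP => [Xj|_]; last first.
  by exists 1; rewrite ?oner_eq0 ?scale1r.
have t0 : t != 0 by apply: ht; apply/existsP; exists j; rewrite Xj.
exists t^-1; first by rewrite invr_eq0.
by rewrite pictureD Xj add0r pictureZ scalerA mulVf ?scale1r.
Qed.

Lemma row_neq0P k (w : 'rV[C]_k) : w != 0 -> exists r, w 0 r != 0.
Proof. by case/rV0Pn => r; exists r. Qed.

(** The curve Q(X + t om, Y + s ze) = 0 in the (t, s)-plane passes through the origin. Where t is
    nonzero if X is focal, and s if Y is, its points give genuine rigid pairs, at which p vanishes.
    The two conditions on Q say that the equation of the curve is not identically zero on the axes t
    = 0 and s = 0, so [polyfun_cancel] extends the vanishing to the origin. *)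
Lemma rigid_ideal_limit p (X Y om ze : 'cV[C]_4) (a b : 'I_n -> C) :
  rigid_ideal A p -> Qform X Y = 0 ->
  (focal_point X -> Qform X (Y + ze) != 0) ->
  (focal_point Y -> Qform (X + om) Y != 0) ->
  (forall j, a j != 0) -> (forall j, b j != 0) ->
  (forall j, limit_picture X om j != 0) ->
  (forall j, limit_picture Y ze j != 0) ->
  reval p (col_mx (\matrix_j (a j *: limit_picture X om j))
                  (\matrix_j (b j *: limit_picture Y ze j))) = 0.
Proof.
move=> hp Q0 hX hY ha hb hu hv.
have /choice[r hr] : forall j, exists r, limit_picture X om j 0 r != 0.
  by move=> j; exact: row_neq0P.
have /choice[s hs] : forall j, exists s, limit_picture Y ze j 0 s != 0.
  by move=> j; exact: row_neq0P.
pose i0 : 'I_2 := 0; pose i1 : 'I_2 := 1.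
pose X' (x : 'I_2 -> C) := X + x i0 *: om.
pose Y' (x : 'I_2 -> C) := Y + x i1 *: ze.
have pX : polymx X'.
  by apply: polymxD; [exact: polymx_cst|apply: polymxZ; [exact: polyfun_var|exact: polymx_cst]].
have pY : polymx Y'.
  by apply: polymxD; [exact: polymx_cst|apply: polymxZ; [exact: polyfun_var|exact: polymx_cst]].
pose U j (x : 'I_2 -> C) := moving_picture X om (x i0) j.
pose V j (x : 'I_2 -> C) := moving_picture Y ze (x i1) j.
have pU j : polymx (U j).
  by apply: polymx_if; apply: polymx_picture => //; exact: polymx_cst.
have pV j : polymx (V j).
  by apply: polymx_if; apply: polymx_picture => //; exact: polymx_cst.
pose W x := col_mx (\matrix_j (a j *: U j x)) (\matrix_j (b j *: V j x)).
(* Multiplying by D discards the parameters at which some moving picture is zero; nothing is lost at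
   the origin, where D is nonzero. *)
pose D x := \prod_j (U j x 0 (r j) * V j x 0 (s j)).
have U0 j : U j (fun=> 0) = limit_picture X om j.
  by rewrite /U /moving_picture scale0r addr0.
have V0 j : V j (fun=> 0) = limit_picture Y ze j.
  by rewrite /V /moving_picture scale0r addr0.
have D0 : D (fun=> 0) != 0.
  by apply/prodf_neq0 => j _; rewrite U0 V0 mulf_neq0.
suff : reval p (W (fun=> 0)) * D (fun=> 0) = 0.
  have EU : \matrix_j (a j *: U j (fun=> 0)) = \matrix_j (a j *: limit_picture X om j).
    by apply/row_matrixP => j; rewrite !rowK U0.
  have EV : \matrix_j (b j *: V j (fun=> 0)) = \matrix_j (b j *: limit_picture Y ze j).
    by apply/row_matrixP => j; rewrite !rowK V0.
  by rewrite /W EU EV => /eqP; rewrite mulf_eq0 (negPf D0) orbF => /eqP.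
pose E (i : 'I_2) := if i == 0 then focal_point X else focal_point Y.
apply: (polyfun_cancel (@complex_uncountable R) (E := E)
    (P := fun x => Qform (X' x) (Y' x)) (G := fun x => reval p (W x) * D x)).
- exact: polyfun_Qform.
- apply: polyfunM.
    apply: polyfun_reval; apply: polymx_col; apply: polymx_rows => j;
    by apply: polymxZ => //; exact: polyfun_cst.
  by apply: polyfun_prod => j; apply: polyfunM; [exact: pU|exact: pV].
- by rewrite /X' /Y' !scale0r !addr0.
- move=> i; rewrite /E; case: ifP => [/eqP -> fX|i0' fY].
    exists (fun i => if i == i1 then 1 else 0) => //.
    by rewrite /X' /Y' /= scale0r scale1r addr0; exact: hX.
  exists (fun j => if j == i0 then 1 else 0); first by rewrite i0'.
  by rewrite /X' /Y' /= scale0r scale1r addr0; exact: hY.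
- move=> x Px Ex; have [->|Dx] := eqVneq (D x) 0; first by rewrite mulr0.
  have {}Dx j : (U j x != 0) /\ (V j x != 0).
    move/prodf_neq0: Dx => /(_ j isT); rewrite mulf_eq0 negb_or => /andP[h1 h2].
    by split; [apply: contraNneq h1|apply: contraNneq h2] => ->; rewrite mxE.
  suff -> : reval p (W x) = 0 by rewrite mul0r.
  apply: (rigid_ideal_pictures hp Px) => j; rewrite rowK.
    have [|c c0 E'] := @moving_pictureP X om (x i0) j; first exact: (Ex i0).
    rewrite /U E'; have [+ _] := Dx j; rewrite /U E' scaler_eq0 negb_or => /andP[_ hpi].
    by split=> //; exists (a j * c); rewrite ?mulf_neq0 // scalerA.
  have [|c c0 E'] := @moving_pictureP Y ze (x i1) j; first exact: (Ex i1).
  rewrite /V E'; have [_ +] := Dx j; rewrite /V E' scaler_eq0 negb_or => /andP[_ hpi].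
  by split=> //; exists (b j * c); rewrite ?mulf_neq0 // scalerA.
Qed.

End RigidIdeal.


(** * Vanishing of the rigid ideal at degenerate pairs *)

Section RigidIdealVanishing.
Variables (R : realType) (n : nat) (A : 'I_n -> 'M[R]_(3, 4)).
Notation C := R[i].
Local Notation pic := (picture A).
Hypothesis hn : (2 <= n)%N.
Hypothesis hrank : forall i, \rank (A i) = 3%N.
Hypothesis hpos : general_position A.

(** The factor c may be 0, and the row of a camera with focal point X is unrestricted. *)
Definition partial_pictures (X : 'cV[C]_4) (u : 'M[C]_(n, 3)) :=
  forall j, pic j X != 0 -> exists c, row j u = c *: pic j X.

(** X is the focal point of at most one camera, so a single direction [om] can be chosen whose
    picture there is the prescribed row. *)
Lemma partial_pictures_limit (X : 'cV[C]_4) u : X != 0 -> partial_pictures X u ->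
  exists om (c : 'I_n -> C), forall j,
    row j u = (if pic j X == 0 then 1 else c j) *: limit_picture A X om j.
Proof.
move=> X0 hu.
have /choice[c hc] : forall j, exists c, pic j X != 0 -> row j u = c *: pic j X.
  move=> j; have [_|/hu[c E]] := eqVneq (pic j X) 0; first by exists 0.
  by exists c.
have [om hom] : exists om, forall j, pic j X = 0 -> pic j om = row j u.
  have [/existsP[j /eqP Xj]|/existsPn nf] := boolP [exists j, pic j X == 0].
    have [om Hom] := picture_surj hrank j (row j u); exists om => k Xk.
    have [<- //|jk] := eqVneq j k.
    by move: X0; rewrite (picture_inj2 hrank hpos jk Xj Xk) eqxx.
  by exists 0 => j Xj; have := nf j; rewrite Xj eqxx.
exists om, c => j; rewrite /limit_picture; case: eqP => [Xj|/eqP Xj].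
  by rewrite scale1r hom.
exact: hc.
Qed.

Lemma focal_point_Qform (X Y : 'cV[C]_4) : X != 0 -> focal_point A X ->
  exists Y', Qform X (Y + Y') != 0.
Proof.
move=> X0 /existsP[j /eqP /(focal_real hrank)[z [c E]]].
have [|Y' QY] := @Qform_real_nondeg R c z; first by rewrite -E.
by exists (Y' - Y); rewrite addrC subrK E.
Qed.

Lemma polymx_limit N (X : 'cV[C]_4) (om : ('I_N -> C) -> 'cV[C]_4) j :
  polymx om -> polymx (fun x => limit_picture A X (om x) j).
Proof.
move=> pom; apply: polymx_if; last exact: polymx_cst.
exact: polymx_picture.
Qed.

Lemma limit_picture_generic (X : 'cV[C]_4) j :
  exists om r, limit_picture A X om j 0 r != 0.
Proof.
rewrite /limit_picture; case: eqP => [_|/eqP Xj].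
  have [om E] := picture_surj hrank j (const_mx 1).
  by exists om, 0; rewrite E mxE oner_eq0.
by have [r hr] := row_neq0P Xj; exists 0, r.
Qed.

(** With X and Y fixed, the directions and scaling factors are deformed. The nonvanishing conditions
    of [rigid_ideal_limit] hold for generic parameters, and the value of p depends polynomially on
    them. *)
Lemma rigid_ideal_vanishes p (X Y : 'cV[C]_4) u v : rigid_ideal A p ->
  X != 0 -> Y != 0 -> Qform X Y = 0 ->
  partial_pictures X u -> partial_pictures Y v ->
  reval p (col_mx u v) = 0.
Proof.
move=> hp X0 Y0 Q0 /(partial_pictures_limit X0)[om [c Eu]].
move=> /(partial_pictures_limit Y0)[ze [d Ev]].
(* Nine parameters: a shift of [om], a shift of [ze], and one shift [tau] common to all the factors
   [c j] and [d j]. *)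
pose vec (x : 'I_(4 + 4 + 1) -> C) : 'cV_(4 + 4 + 1) := \col_k x k.
pose om' x := om + usubmx (usubmx (vec x)).
pose ze' x := ze + dsubmx (usubmx (vec x)).
pose tau x : C := dsubmx (vec x) 0 0.
pose pt a b t : 'I_(4 + 4 + 1) -> C := fun k => col_mx (col_mx a b) t%:M k 0.
have vecK a b t : vec (pt a b t) = col_mx (col_mx a b) t%:M.
  by apply/colP => k; rewrite mxE.
have om'K a b t : om' (pt a b t) = om + a by rewrite /om' vecK !col_mxKu.
have ze'K a b t : ze' (pt a b t) = ze + b by rewrite /ze' vecK col_mxKu col_mxKd.
have tauK a b t : tau (pt a b t) = t by rewrite /tau vecK col_mxKd mxE eqxx.
have pom : polymx om'.
  apply: polymxD; first exact: polymx_cst.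
  move=> k l; apply: polyfun_ext (polyfun_var _ (lshift 1 (lshift 4 k))) => x.
  by rewrite !mxE.
have pze : polymx ze'.
  apply: polymxD; first exact: polymx_cst.
  move=> k l; apply: polyfun_ext (polyfun_var _ (lshift 1 (rshift 4 k))) => x.
  by rewrite !mxE.
have ptau : polyfun tau.
  apply: polyfun_ext (polyfun_var _ (rshift (4 + 4) (0 : 'I_1))) => x.
  by rewrite /tau !mxE.
have shift_poly (e : C) : polyfun (fun x => e + tau x).
  by apply: polyfunD => //; exact: polyfun_cst.
pose a x j := if pic j X == 0 then 1 else c j + tau x.
pose b x j := if pic j Y == 0 then 1 else d j + tau x.
have pa j : nzpolyfun (fun x => a x j).
  rewrite /a; case: (pic j X == 0); (split; [|exists (pt 0 0 (1 - c j)); rewrite ?tauK]).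
  - exact: polyfun_cst.
  - exact: oner_neq0.
  - exact: shift_poly.
  - by rewrite addrC subrK oner_neq0.
have pb j : nzpolyfun (fun x => b x j).
  rewrite /b; case: (pic j Y == 0); (split; [|exists (pt 0 0 (1 - d j)); rewrite ?tauK]).
  - exact: polyfun_cst.
  - exact: oner_neq0.
  - exact: shift_poly.
  - by rewrite addrC subrK oner_neq0.
have /choice[r hr] : forall j, exists r,
    exists om, limit_picture A X om j 0 r != 0.
  by move=> j; have [om0 [r]] := limit_picture_generic X j; exists r, om0.
have /choice[s hs] : forall j, exists s,
    exists ze, limit_picture A Y ze j 0 s != 0.
  by move=> j; have [ze0 [s]] := limit_picture_generic Y j; exists s, ze0.
have pu j : nzpolyfun (fun x => limit_picture A X (om' x) j 0 (r j)).
  split; first exact: polymx_limit.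
  have [om0 h] := hr j; exists (pt (om0 - om) 0 0).
  by rewrite om'K addrC subrK.
have pv j : nzpolyfun (fun x => limit_picture A Y (ze' x) j 0 (s j)).
  split; first exact: polymx_limit.
  have [ze0 h] := hs j; exists (pt 0 (ze0 - ze) 0).
  by rewrite ze'K addrC subrK.
pose qX x := if focal_point A X then Qform X (Y + ze' x) else 1.
pose qY x := if focal_point A Y then Qform (X + om' x) Y else 1.
have pqX : nzpolyfun qX.
  rewrite /qX; case: (boolP (focal_point A X)) => fX; last first.
    by split; [exact: polyfun_cst|exists (pt 0 0 0); exact: oner_neq0].
  split.
    apply: polyfun_Qform; first exact: polymx_cst.
    by apply: polymxD => //; exact: polymx_cst.
  have [Y' h] := focal_point_Qform (Y + ze) X0 fX.
  by exists (pt 0 Y' 0); rewrite ze'K addrA.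
have pqY : nzpolyfun qY.
  rewrite /qY; case: (boolP (focal_point A Y)) => fY; last first.
    by split; [exact: polyfun_cst|exists (pt 0 0 0); exact: oner_neq0].
  split.
    apply: polyfun_Qform; last exact: polymx_cst.
    by apply: polymxD => //; exact: polymx_cst.
  have [X' h] := focal_point_Qform (X + om) Y0 fY.
  by exists (pt X' 0 0); rewrite om'K QformC addrA.
pose W x := col_mx (\matrix_j (a x j *: limit_picture A X (om' x) j))
                   (\matrix_j (b x j *: limit_picture A Y (ze' x) j)).
have pW : polymx W.
  apply: polymx_col; apply: polymx_rows => j; apply: polymxZ.
  - by case: (pa j).
  - exact: polymx_limit.
  - by case: (pb j).
  - exact: polymx_limit.
have -> : col_mx u v = W (pt 0 0 0).
  rewrite /W; congr col_mx; apply/row_matrixP => j; rewrite rowK.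
    by rewrite om'K addr0 /a tauK addr0.
  by rewrite ze'K addr0 /b tauK addr0.
apply: (polyfun_generic (@complex_uncountable R) (f := fun x => reval p (W x))
  (g := fun x => \prod_j (a x j * b x j *
          (limit_picture A X (om' x) j 0 (r j) * limit_picture A Y (ze' x) j 0 (s j)))
        * (qX x * qY x))).
- exact: polyfun_reval.
- have unc := @complex_uncountable R.
  apply: (nzpolyfunM unc); last exact: (nzpolyfunM unc).
  apply: (nzpolyfun_prod unc) => j.
  by apply: (nzpolyfunM unc); apply: (nzpolyfunM unc).
- move=> x; rewrite !mulf_eq0 !negb_or => /andP[/prodf_neq0 h /andP[hX hY]].
  have {}h j : [/\ a x j != 0, b x j != 0, limit_picture A X (om' x) j != 0
      & limit_picture A Y (ze' x) j != 0].
    have := h j isT; rewrite !mulf_eq0 !negb_or => /andP[/andP[h1 h2] /andP[h3 h4]].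
    by split=> //; [apply: contraNneq h3|apply: contraNneq h4] => ->; rewrite mxE.
  apply: (rigid_ideal_limit hn hp Q0).
  + by move=> fX; move: hX; rewrite /qX fX.
  + by move=> fY; move: hY; rewrite /qY fY.
  + by move=> j; case: (h j).
  + by move=> j; case: (h j).
  + by move=> j; case: (h j).
  + by move=> j; case: (h j).
Qed.

End RigidIdealVanishing.


(** * Minors and wedges of matrices of corank one *)

Section Minors.
Variable F : fieldType.

Lemma rV_full_minors m q (M : 'M[F]_(m, q)) :
  (forall f : 'I_m -> 'I_q, \det (colsub f M) = 0) ->
  exists2 v : 'rV_m, v != 0 & v *m M = 0.
Proof.
move=> h; have [free|] := boolP (row_free M); last first.
  rewrite -kermx_eq0 => /rowV0Pn[v /sub_kermxP vM v0]; by exists v.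
have full : row_full M^T by rewrite /row_full mxrank_tr.
have := fullrowsub_unit full; rewrite unitmxE unitfE -det_tr trmx_mxsub trmxK.
by rewrite h eqxx.
Qed.

(** Take a left kernel vector y and i with y_i nonzero: row i is a combination of the others, so
    deleting it keeps the kernel. Take k with z_k nonzero: no nonzero kernel vector vanishes at k,
    so deleting column k leaves an invertible matrix. *)
Lemma corank1_minor m (B : 'M[F]_m.+1) (z : 'cV_m.+1) : z != 0 ->
  B *m z = 0 -> (forall z', B *m z' = 0 -> exists c, z' = c *: z) ->
  exists i, (forall w : 'cV_m.+1, row' i B *m w = 0 -> B *m w = 0) /\
    exists k, \det (row' i (col' k B)) != 0.
Proof.
move=> z0 Bz hz.
have [y y0 yB] : exists2 y : 'rV_m.+1, y != 0 & y *m B = 0.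
  apply/det0P; rewrite -det_tr; apply/det0P; exists z^T.
    by rewrite -(inj_eq trmx_inj) trmxK trmx0.
  by rewrite -trmx_mul Bz trmx0.
have /rV0Pn[i yi] := y0.
have /cV0Pn[k zk] := z0.
have ker (w : 'cV_m.+1) : row' i B *m w = 0 -> B *m w = 0.
  move=> Bw; have Bwl r : (B *m w) (lift i r) 0 = 0.
    have := congr1 (fun M : 'cV_m => M r 0) Bw; rewrite !mxE => E.
    by apply: etrans E; apply: eq_bigr => j _; rewrite mxE.
  have : (y *m (B *m w)) 0 0 = 0 by rewrite mulmxA yB mul0mx mxE.
  rewrite mxE (bigD1 i) //= big1 ?addr0 => [|j]; last first.
    by rewrite eq_sym => /unlift_some[r -> _]; rewrite Bwl mulr0.
  move/eqP; rewrite mulf_eq0 (negPf yi) /= => /eqP Bwi.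
  apply/colP => j; rewrite [RHS]mxE.
  by have [r ->|->] := unliftP i j.
exists i; split => //; exists k; rewrite -det_tr; apply/det0P => -[w w0 wM].
pose w' : 'cV_m.+1 := \col_j (if unlift k j is Some r then w 0 r else 0).
have /ker/hz[c Ec] : row' i B *m w' = 0.
  apply/colP => r; rewrite !mxE (bigD1_ord k) //= !mxE unlift_none mulr0 add0r.
  have := congr1 (fun M : 'rV_m => M 0 r) wM; rewrite !mxE => E.
  by apply: etrans E; apply: eq_bigr => j _; rewrite !mxE liftK mulrC.
have c0 : c = 0.
  have := congr1 (fun M : 'cV_m.+1 => M k 0) Ec; rewrite !mxE unlift_none.
  by move/esym/eqP; rewrite mulf_eq0 (negPf zk) orbF => /eqP.
move: w0; rewrite -[w](_ : 0 = _) ?eqxx //; apply/rowP => r.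
have := congr1 (fun M : 'cV_m.+1 => M (lift k r) 0) Ec.
by rewrite c0 scale0r !mxE liftK.
Qed.

End Minors.

Section Wedge.
Variable F : fieldType.

Lemma wedge5_corank1 (B : 'M[F]_6) (z : 'cV_6) : z != 0 -> B *m z = 0 ->
  (forall z', B *m z' = 0 -> exists c, z' = c *: z) ->
  exists i, exists2 c, c != 0 & wedge5 (row' i B : 'M_(5, 6)) = c *: z.
Proof.
move=> z0 Bz hz; have [i [ker [k dk]]] := corank1_minor z0 Bz hz.
have [c Ec] := hz _ (ker _ (mulmx_wedge5 (row' i B : 'M_(5, 6)))).
exists i, c => //; apply: contraNneq dk => c0; move: Ec; rewrite c0 scale0r.
move/(congr1 (fun M : 'cV_6 => M k 0)); rewrite !mxE => /eqP.
rewrite mulf_eq0 signr_eq0 /= => /eqP <-; apply/eqP; congr (\det _).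
by apply/matrixP => r s; rewrite !mxE.
Qed.

End Wedge.

(** * Evaluation of real polynomials at complex matrices *)

Section RealEvaluation.
Variable R : realType.
Notation C := R[i].
Local Notation rc := (real_complex R).

(* Convertible to reval, but visibly a ring morphism.                         *)
Definition eval_rmorphism m (w : 'M[C]_(m, 3)) : {rmorphism {mpoly R[m * 3]} -> C} :=
  (meval (fun k => mxvec w 0 k) \o map_mpoly rc : {rmorphism _ -> _}).

Lemma eval_rmorphismE m (w : 'M[C]_(m, 3)) p : eval_rmorphism w p = reval p w.
Proof. by []. Qed.

Lemma revalC m (w : 'M[C]_(m, 3)) c : reval c%:MP w = rc c.
Proof. by rewrite /reval /ceval map_mpolyC mevalC. Qed.

Lemma revalXU m (w : 'M[C]_(m, 3)) k : reval 'X_k w = mxvec w 0 k.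
Proof. by rewrite /reval /ceval map_mpolyX mevalXU. Qed.

Lemma revalX_index m (w : 'M[C]_(m, 3)) i a :
  reval 'X_(mxvec_index i a) w = w i a.
Proof. by rewrite revalXU mxvecE. Qed.

End RealEvaluation.

(** * Points of P^3 from the multiview equations *)

Section MultiviewMatrix.
Variables (R : realType) (n : nat) (A : 'I_n -> 'M[R]_(3, 4)).
Notation C := R[i].
Local Notation pic := (picture A).
Local Notation rc := (real_complex R).
Implicit Types (U : pred 'I_n).

(* The columns are indexed by the entries of u.  The row (x, l) lies in the   *)
(* left kernel iff A_j x + l_j u_j = 0 for j in U and l_j = 0 for j not in U. *)
Definition multiview_mx (T : comNzRingType) (phi : R -> T) (u : 'M[T]_(n, 3)) U :=
  col_mx
    (\matrix_(k < 4, q < #|{: 'I_n * 'I_3}|)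
       let: (j, r) := enum_val q in if U j then phi (A j r k) else 0)
    (\matrix_(l < n, q < #|{: 'I_n * 'I_3}|)
       let: (j, r) := enum_val q in
       if l == j then if U j then u j r else (r == 0)%:R else 0).

Lemma mul_multiview_mx (x : 'cV[C]_4) (l : 'rV[C]_n) (u : 'M[C]_(n, 3)) U j r :
  (row_mx x^T l *m multiview_mx rc u U) 0 (enum_rank (j, r)) =
  if U j then pic j x 0 r + l 0 j * u j r else l 0 j * (r == 0)%:R.
Proof.
rewrite mul_row_col !mxE [X in _ + X](bigD1 j) //= mxE enum_rankK eqxx.
rewrite [X in _ + (_ + X)]big1 ?addr0 => [|k kj]; last first.
  by rewrite mxE enum_rankK (negPf kj) mulr0.
case: ifP => Uj; last first.
  by rewrite big1 ?add0r // => k _; rewrite !mxE enum_rankK Uj mulr0.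
congr (_ + _); apply: eq_bigr => k _.
by rewrite !mxE enum_rankK Uj mulrC.
Qed.

Lemma multiview_idealP f : (forall X u, X != 0 -> pictures_of A X u -> reval f u = 0) ->
  multiview_ideal A f.
Proof. by move=> h w [_ hw]; apply: hw => w' [X X0 hX]; exact: h hX. Qed.

(** Zero rows impose nothing and l may be 0, so the solutions X form a linear space. *)
Definition in_cone (X : 'cV[C]_4) (u : 'M[C]_(n, 3)) :=
  forall j, row j u != 0 -> exists l, pic j X = l *: row j u.

(** With U the set of nonzero rows of u, the maximal minors of [multiview_mx] vanish at all
    pictures, hence at u. A left kernel vector (x, l) results. If x were 0, each l_j u_j with j in U
    would be 0, so l would be 0 as well. *)
Lemma multiview_point u :
  (forall f, multiview_ideal A f -> reval f u = 0) -> exists2 X, X != 0 & in_cone X u.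
Proof.
move=> hu; pose U j := row j u != 0.
pose vars : 'M[{mpoly R[n * 3]}]_(n, 3) := \matrix_(j, r) 'X_(mxvec_index j r).
have ev w : map_mx (eval_rmorphism w) (multiview_mx (@mpolyC _ R) vars U)
    = multiview_mx rc w U.
  rewrite map_col_mx; congr col_mx; apply/matrixP => k q; rewrite !mxE;
    case: (enum_val q) => j r.
    by case: (U j); rewrite ?rmorph0 // eval_rmorphismE revalC.
  case: (k == j); rewrite ?rmorph0 //; case: (U j).
    by rewrite mxE eval_rmorphismE revalX_index.
  by rewrite rmorph_nat.
have evdet w (f : 'I_(4 + n) -> 'I_#|{: 'I_n * 'I_3}|) :
    reval (\det (colsub f (multiview_mx (@mpolyC _ R) vars U))) w =
    \det (colsub f (multiview_mx rc w U)).
  by rewrite -eval_rmorphismE -det_map_mx map_mxsub ev.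
have [f|v v0 vM] := @rV_full_minors _ _ _ (multiview_mx rc u U).
  rewrite -evdet; apply: hu; apply: multiview_idealP => X w X0 hX.
  rewrite evdet; have /choice[a ha] : forall j, exists a, a != 0 /\ row j w = a *: pic j X.
    by move=> j; have [_ [a]] := hX j; exists a.
  pose l := \row_j (if U j then - (a j)^-1 else 0).
  have lE j : l 0 j = if U j then - (a j)^-1 else 0 by rewrite mxE.
  apply/eqP/det0P; exists (row_mx X^T l).
    apply: contra X0 => /eqP; rewrite -row_mx0 => /eq_row_mx[/eqP].
    by rewrite -(inj_eq trmx_inj) trmxK trmx0.
  rewrite mulmx_colsub; apply/rowP => c; rewrite [LHS]mxE [RHS]mxE.
  rewrite -[f c]enum_valK; case: (enum_val (f c)) => j r.
  rewrite mul_multiview_mx lE.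
  case: (U j); last by rewrite mul0r.
  have [a0] := ha j; move: (pic j X) => q /rowP/(_ r); rewrite !mxE => ->.
  by rewrite mulrA mulNr mulVf // mulN1r subrr.
pose x := (lsubmx v)^T; pose l := rsubmx v.
have key j r := mul_multiview_mx x l u U j r.
rewrite /x /l trmxK hsubmxK vM in key.
have l0 j : ~~ U j -> l 0 j = 0.
  by move=> Uj; have := key j 0; rewrite mxE (negPf Uj) eqxx mulr1.
have E j : U j -> pic j x = - l 0 j *: row j u.
  move=> Uj; apply/rowP => r; have := key j r; rewrite [LHS]mxE Uj => /esym/eqP.
  by rewrite addr_eq0 => /eqP ->; rewrite !mxE mulNr.
exists x; last by move=> j Uj; exists (- l 0 j); exact: E.
apply: contra v0 => /eqP x0; rewrite -[v]hsubmxK -/l.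
have -> : lsubmx v = 0 by rewrite -[lsubmx v]trmxK -/x x0 trmx0.
rewrite -row_mx0; apply/eqP; congr row_mx; apply/rowP => j; rewrite [RHS]mxE.
have [Uj|/l0 //] := boolP (U j).
have := E j Uj; rewrite x0 picture0 => /esym/eqP.
by rewrite scaler_eq0 (negPf Uj) orbF oppr_eq0 => /eqP.
Qed.

End MultiviewMatrix.


(** * Cones over image points, and zeros of the octics *)

Lemma Tform_scale4 (F : fieldType) (a b c d : F) (X Y : 'cV[F]_4) : (2 : F) != 0 ->
  Tform (a *: X) (b *: X) (c *: Y) (d *: Y) = a * b * (c * d) * Qform X Y.
Proof.
move=> u2; rewrite -(Tform_diag _ _ (_ : (2 : F) \is a GRing.unit)) ?unitfE //.
rewrite /Tform mulrBr mulr_sumr; move: (2^-1 : F) => h.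
congr (_ - _); last by rewrite /Defs.hom !mxE; ring.
by apply: eq_bigr => i _; rewrite /aff /Defs.hom !mxE; ring.
Qed.

Section Pencil.
Variable R : realType.
Notation C := R[i].

(** Along the pencil Q is a polynomial in t with leading term Q(X1, Y) t^2, so it has a complex root
    when that coefficient is nonzero. *)
Lemma Qform_pencil (X1 X2 Y : 'cV[C]_4) :
  Qform X1 Y = 0 \/ exists t, Qform (X2 + t *: X1) Y = 0.
Proof.
have [|Q1] := eqVneq (Qform X1 Y) 0; first by left.
right; pose q := Qform (X1 + X2) Y - Qform X1 Y - Qform X2 Y.
have E t : Qform (X2 + t *: X1) Y = Qform X1 Y * t ^+ 2 + q * t + Qform X2 Y.
  rewrite /q /Qform /aff /Defs.hom !big_ord_recr !big_ord0 /= !mxE; ring.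
pose p : {poly C} := Qform X1 Y *: 'X^2 + q *: 'X + (Qform X2 Y)%:P.
have [|t] := closed_rootP p _.
  apply: contra Q1 => /eqP h; have := size1_polyC (eq_leq h).
  move/(congr1 (fun r : {poly C} => r`_2)).
  by rewrite !coefD !coefZ coefXn coefX !coefC mulr1 mulr0 !addr0 => ->.
rewrite rootE !hornerD !hornerZ hornerXn hornerX hornerC => /eqP E0.
by exists t; rewrite E.
Qed.

End Pencil.

Section RigidZeros.
Variables (R : realType) (n : nat) (A : 'I_n -> 'M[R]_(3, 4)).
Notation C := R[i].
Local Notation pic := (picture A).
Local Notation rc := (real_complex R).
Hypothesis hn : (2 <= n)%N.
Hypothesis hrank : forall i, \rank (A i) = 3%N.
Hypothesis hpos : general_position A.

(* The points of P^3 with picture u_j; the line through the focal point and   *)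
(* the points over u_j.                                                       *)
Definition line_over (u : 'M[C]_(n, 3)) j : 'M[C]_4 :=
  kermx (map_mx rc (A j)^T *m cokermx (row j u)).

Lemma line_overP u j (X : 'cV[C]_4) :
  reflect (exists l, pic j X = l *: row j u) (X^T <= line_over u j)%MS.
Proof.
apply: (iffP sub_kermxP) => [|[l E]]; rewrite mulmxA -picture_tr.
  by move/eqP; rewrite -submxE => /sub_rVP.
by apply/eqP; rewrite -submxE; apply/sub_rVP; exists l.
Qed.

Lemma rank_line_over u j : row j u != 0 -> \rank (line_over u j) = 2%N.
Proof.
move=> uj; rewrite mxrank_ker eqmxMfull; last first.
  by rewrite /row_full mxrank_map mxrank_tr hrank.
by rewrite mxrank_coker rank_rV uj.
Qed.

Definition cone_over (u : 'M[C]_(n, 3)) : 'M[C]_4 :=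
  (\bigcap_(j | row j u != 0) line_over u j)%MS.

Lemma cone_overP u (X : 'cV[C]_4) :
  reflect (in_cone A X u) (X^T <= cone_over u)%MS.
Proof.
apply: (iffP sub_bigcapmxP) => h j uj; first exact/line_overP/h.
exact/line_overP/h.
Qed.

(** Not all rows are zero, since the empty intersection is the whole space. If all lines over
    nonzero rows contained one of them, the cone would have rank 2. So two of them differ, and they
    meet in at most a point. *)
Lemma cone_over_rank1 u : (\rank (cone_over u) <= 1)%N -> exists j k : 'I_n,
  [/\ (j < k)%N, row j u != 0, row k u != 0
    & (\rank (line_over u j :&: line_over u k)%MS <= 1)%N].
Proof.
move=> h; have [j uj] : exists j, row j u != 0.
  apply: contrapT => nex; move: h; rewrite /cone_over big_pred0 ?mxrank1 //.
  by move=> j; apply/negbTE/negP => uj; apply: nex; exists j.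
have [k uk njk] : exists2 k, row k u != 0 & ~~ (line_over u j <= line_over u k)%MS.
  apply: contrapT => nex; have : (line_over u j <= cone_over u)%MS.
    apply/sub_bigcapmxP => k uk; apply/negPn/negP => njk.
    by apply: nex; exists k.
  by move/mxrankS; rewrite rank_line_over // leqNgt ltnS h.
have cap : (\rank (line_over u j :&: line_over u k)%MS <= 1)%N.
  rewrite leqNgt; apply: contra njk => r2.
  have : (line_over u j :&: line_over u k == line_over u j)%MS.
    by rewrite -(geq_leqif (mxrank_leqif_eq (capmxSl _ _))) rank_line_over.
  by move=> /andP[_ /submx_trans]; apply; exact: capmxSr.
have [jk|kj|jk] := ltngtP (val j) (val k).
- by exists j, k.
- by exists k, j; rewrite capmxC.
- by move: njk; rewrite (val_inj jk) submx_refl.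
Qed.

(** Stated over any ring, so that [pair_mx] and its complex values are two instances related by a
    ring morphism. *)
Definition generic_pair_mx (T : comPzRingType) (phi : R -> T) (x : 'M[T]_(n, 3)) j k : 'M[T]_6 :=
  col_mx (row_mx (map_mx phi (A j)) (row_mx (row j x)^T (0 : 'cV_3)))
         (row_mx (map_mx phi (A k)) (row_mx (0 : 'cV_3) (row k x)^T)).

Lemma map_generic_pair_mx (T T' : comPzRingType) (f : {rmorphism T -> T'})
    (phi : R -> T) (phi' : R -> T') x j k : (forall a, f (phi a) = phi' a) ->
  map_mx f (generic_pair_mx phi x j k) = generic_pair_mx phi' (map_mx f x) j k.
Proof.
move=> h; have cstE (N : 'M[R]_(3, 4)) : map_mx f (map_mx phi N) = map_mx phi' N.
  by apply/matrixP => r s; rewrite !mxE h.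
transitivity (map_mx f (generic_pair_mx phi x j k : 'M_(3 + 3, 4 + (1 + 1)))).
  by [].
by rewrite /generic_pair_mx map_col_mx !map_row_mx !cstE !map_mx0 -!map_trmx !map_row.
Qed.

Definition complex_pair_mx (u : 'M[C]_(n, 3)) j k : 'M[C]_6 :=
  generic_pair_mx rc u j k.

Lemma mul_complex_pair_mx u j k (X : 'cV[C]_4) (l m : C) :
  complex_pair_mx u j k *m (col_mx X (col_mx l%:M m%:M) : 'cV_(4 + (1 + 1))) =
  col_mx (pic j X + l *: row j u)^T (pic k X + m *: row k u)^T.
Proof.
transitivity (mulmx (complex_pair_mx u j k : 'M_(3 + 3, 4 + (1 + 1)))
  (col_mx X (col_mx l%:M m%:M))); first by [].
rewrite /complex_pair_mx /generic_pair_mx mul_col_mx.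
rewrite !mul_row_col !mul0mx addr0 add0r.
by rewrite !mul_mx_scalar !linearD !linearZ /= !trmxK.
Qed.

(** The two lines meet only in X and the rows are nonzero, so the kernel of the pair matrix is
    spanned by (X, - l, - m). By [wedge5_corank1] some row deletion has this vector, up to a nonzero
    factor, as its wedge. *)
Lemma pair_wedge u j k (X : 'cV[C]_4) : X != 0 -> in_cone A X u ->
  row j u != 0 -> row k u != 0 ->
  (\rank (line_over u j :&: line_over u k)%MS <= 1)%N ->
  exists i, exists2 c, c != 0 &
    wedge5_4 (row' i (complex_pair_mx u j k) : 'M_(5, 6)) = c *: X.
Proof.
move=> X0 hX uj uk rk; have [[l El] [m Em]] := (hX _ uj, hX _ uk).
pose z : 'cV[C]_6 := (col_mx X (col_mx (- l)%:M (- m)%:M) : 'cV_(4 + (1 + 1))).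
have [|||i [c c0 E]] := @wedge5_corank1 _ (complex_pair_mx u j k) z.
- apply: contra X0 => /eqP/(congr1 (@usubmx C 4 (1 + 1) 1)).
  by rewrite /z col_mxKu linear0 => ->.
- by rewrite mul_complex_pair_mx El Em !scaleNr !subrr trmx0 col_mx0.
- move=> z' Bz'; pose w : 'cV[C]_(4 + (1 + 1)) := z'.
  pose Y := usubmx w; pose a := usubmx (dsubmx w) 0 0; pose b := dsubmx (dsubmx w) 0 0.
  have Ew : w = col_mx Y (col_mx a%:M b%:M).
    by rewrite -[LHS]vsubmxK -[dsubmx w]vsubmxK -!mx11_scalar.
  have : complex_pair_mx u j k *m w = 0 by exact: Bz'.
  rewrite Ew mul_complex_pair_mx => E0.
  have /eq_col_mx[] : col_mx (pic j Y + a *: row j u)^T (pic k Y + b *: row k u)^T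
      = col_mx 0 0 by rewrite col_mx0; exact: E0.
  move=> /eqP; rewrite -(trmx0 _ 1 3) (inj_eq trmx_inj) addr_eq0 -scaleNr => /eqP Ea.
  move=> /eqP; rewrite (inj_eq trmx_inj) addr_eq0 -scaleNr => /eqP Eb.
  have Ycap : (Y^T <= line_over u j :&: line_over u k)%MS.
    by rewrite sub_capmx; apply/andP; split; apply/line_overP; [exists (- a)|exists (- b)].
  have Xcap : (X^T <= line_over u j :&: line_over u k)%MS.
    by rewrite sub_capmx; apply/andP; split; apply/line_overP; [exists l|exists m].
  have XT0 : X^T != 0 by rewrite -(inj_eq trmx_inj) trmxK trmx0.
  have /andP[_ capX] : (X^T == line_over u j :&: line_over u k)%MS.
    by rewrite -(geq_leqif (mxrank_leqif_eq Xcap)) rank_rV XT0.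
  have /sub_rVP[c Ec] := submx_trans Ycap capX.
  have {}Ec : Y = c *: X by rewrite -[Y]trmxK Ec linearZ /= trmxK.
  exists c; have -> : z' = w by []. 
  have inj (v : 'rV[C]_3) s t : v != 0 -> s *: v = t *: v -> s = t.
    move=> v0 /eqP; rewrite -subr_eq0 -scalerBl scaler_eq0 (negPf v0) orbF subr_eq0.
    by move/eqP.
  have {}Ea : a = - (c * l).
    apply: (inj _ _ _ uj); rewrite scaleNr -scalerA -El -pictureZ -Ec Ea.
    by rewrite scaleNr opprK.
  have {}Eb : b = - (c * m).
    apply: (inj _ _ _ uk); rewrite scaleNr -scalerA -Em -pictureZ -Ec Eb.
    by rewrite scaleNr opprK.
  rewrite Ew Ec Ea Eb.
  transitivity (c *: col_mx X (col_mx (- l)%:M (- m)%:M)); last by [].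
  by rewrite !scale_col_mx !scale_scalar_mx !mulrN.
exists i, c => //; rewrite /wedge5_4 E linearZ /=; congr (_ *: _).
exact: col_mxKu.
Qed.

Lemma Qform_cone_pencil u (Y : 'cV[C]_4) : (1 < \rank (cone_over u))%N ->
  exists2 X, X != 0 & in_cone A X u /\ Qform X Y = 0.
Proof.
move=> h; have /rowV0Pn[x1 x1L x10] : cone_over u != 0.
  by rewrite -mxrank_eq0 -lt0n ltnW.
have [i x2] : exists i, ~~ (row i (cone_over u) <= x1)%MS.
  apply/row_subPn; apply: contraL h => /mxrankS.
  by rewrite rank_rV x10 -leqNgt.
set x2' := row i _ in x2.
have x2L : (x2' <= cone_over u)%MS by exact: row_sub.
have [Q1|[t Q2]] := Qform_pencil x1^T x2'^T Y.
  exists x1^T; first by rewrite -(inj_eq trmx_inj) trmxK trmx0.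
  by split => //; apply/cone_overP; rewrite trmxK.
exists (x2'^T + t *: x1^T); last first.
  split=> //; apply/cone_overP; rewrite linearD linearZ /= !trmxK.
  by apply: addmx_sub => //; exact: scalemx_sub.
apply: contra x2 => /eqP/(congr1 trmx); rewrite linearD linearZ /= !trmxK trmx0.
by move/eqP; rewrite addr_eq0 => /eqP ->; rewrite eqmx_opp scalemx_sub.
Qed.

Lemma in_cone_partial (X : 'cV[C]_4) u : in_cone A X u -> partial_pictures A X u.
Proof.
move=> h j Xj; have [->|/h[l El]] := eqVneq (row j u) 0; first by exists 0; rewrite scale0r.
have l0 : l != 0 by apply: contraNneq Xj => l0; rewrite El l0 scale0r.
by exists l^-1; rewrite El scalerA mulVf ?scale1r.
Qed.

Lemma Tform_map (S S' : comUnitRingType) (f : {rmorphism S -> S'}) (X X' Y Y' : 'cV[S]_4) :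
  (2 : S) \is a GRing.unit ->
  f (Tform X X' Y Y') = Tform (map_mx f X) (map_mx f X') (map_mx f Y) (map_mx f Y').
Proof.
move=> u2; rewrite /Tform rmorphB rmorph_sum /aff /Defs.hom !rmorphM !mxE.
congr (_ - _); apply: eq_bigr => i _; rewrite !mxE.
by rewrite rmorphB !rmorphD !rmorphM !rmorphD !rmorphM /= rmorphV // rmorph_nat.
Qed.

Lemma Tform_map_eq (S S' : comUnitRingType) (f : {rmorphism S -> S'})
    (X X' Y Y' : 'cV[S]_4) (Z Z' W W' : 'cV[S']_4) :
  (2 : S) \is a GRing.unit ->
  map_mx f X = Z -> map_mx f X' = Z' -> map_mx f Y = W -> map_mx f Y' = W' ->
  f (Tform X X' Y Y') = Tform Z Z' W W'.
Proof. by move=> u2 <- <- <- <-; exact: Tform_map. Qed.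

Lemma wedge5_4_map (S S' : comPzRingType) (f : {rmorphism S -> S'}) (M : 'M[S]_(5, 6)) :
  map_mx f (wedge5_4 M) = wedge5_4 (map_mx f M).
Proof.
apply/colP => k; rewrite !mxE rmorphM rmorph_sign; congr (_ * _).
rewrite -det_map_mx; congr (\det _).
by apply/matrixP => r s; rewrite !mxE.
Qed.

Lemma two_unit_mpoly (K : numFieldType) N : (2 : {mpoly K[N]}) \is a GRing.unit.
Proof.
by rewrite -(rmorph_nat (@mpolyC N K)) rmorph_unit // unitfE pnatr_eq0.
Qed.

Lemma eval_pair_mx w j k (x : 'M[{mpoly R[(n + n) * 3]}]_(n, 3)) :
  map_mx (eval_rmorphism w) (pair_mx A x j k)
  = complex_pair_mx (map_mx (eval_rmorphism w) x) j k.
Proof. by apply: map_generic_pair_mx => a; exact: revalC. Qed.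

Lemma eval_uvars u v : map_mx (eval_rmorphism (col_mx u v)) (uvars R n) = u.
Proof.
by apply/matrixP => i r; rewrite !mxE eval_rmorphismE revalX_index col_mxEu.
Qed.

Lemma eval_vvars u v : map_mx (eval_rmorphism (col_mx u v)) (vvars R n) = v.
Proof.
by apply/matrixP => i r; rewrite !mxE eval_rmorphismE revalX_index col_mxEd.
Qed.

Lemma octic_eval u v j1 k1 j2 k2 i1 i2 i3 i4 :
  reval (octic A j1 k1 j2 k2 i1 i2 i3 i4) (col_mx u v) =
  Tform (wedge5_4 (row' i1 (complex_pair_mx u j1 k1) : 'M_(5, 6)))
        (wedge5_4 (row' i2 (complex_pair_mx u j1 k1) : 'M_(5, 6)))
        (wedge5_4 (row' i3 (complex_pair_mx v j2 k2) : 'M_(5, 6)))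
        (wedge5_4 (row' i4 (complex_pair_mx v j2 k2) : 'M_(5, 6))).
Proof.
have row'_map i x j k :
    map_mx (eval_rmorphism (col_mx u v)) (row' i (pair_mx A x j k) : 'M_(5, 6))
    = row' i (complex_pair_mx (map_mx (eval_rmorphism (col_mx u v)) x) j k) :> 'M_(5, 6).
  by rewrite -eval_pair_mx; apply/matrixP => r s; rewrite !mxE.
have wu i j k :
    map_mx (eval_rmorphism (col_mx u v)) (wedge5_4 (row' i (pair_mx A (uvars R n) j k) : 'M_(5, 6)))
    = wedge5_4 (row' i (complex_pair_mx u j k) : 'M_(5, 6)).
  by rewrite wedge5_4_map row'_map eval_uvars.
have wv i j k :
    map_mx (eval_rmorphism (col_mx u v)) (wedge5_4 (row' i (pair_mx A (vvars R n) j k) : 'M_(5, 6)))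
    = wedge5_4 (row' i (complex_pair_mx v j k) : 'M_(5, 6)).
  by rewrite wedge5_4_map row'_map eval_vvars.
rewrite -eval_rmorphismE /octic.
apply: Tform_map_eq.
- exact: two_unit_mpoly.
- exact: wu.
- exact: wu.
- exact: wv.
- exact: wv.
Qed.

(* A cone of dimension at least 2 contains a pencil of points, in which a     *)
(* quadratic equation gives a point X with Q(X, Y) = 0; otherwise X and Y are *)
(* unique, and some octic is a nonzero multiple of Q(X, Y).                   *)
Lemma rigid_zeros u v :
  (forall f, multiview_ideal A f -> reval f u = 0) ->
  (forall f, multiview_ideal A f -> reval f v = 0) ->
  (forall p, is_octic A p -> reval p (col_mx u v) = 0) ->
  forall p, rigid_ideal A p -> reval p (col_mx u v) = 0.
Proof.
move=> hu hv hoct p hp.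
have [[X X0 hX] [Y Y0 hY]] := (multiview_point hu, multiview_point hv).
have [ru|ru] := ltnP 1 (\rank (cone_over u)).
  have [X' X'0 [hX' Q0]] := Qform_cone_pencil Y ru.
  apply: (rigid_ideal_vanishes hn hrank hpos hp X'0 Y0 Q0);
    exact: in_cone_partial.
have [rv|rv] := ltnP 1 (\rank (cone_over v)).
  have [Y' Y'0 [hY' Q0]] := Qform_cone_pencil X rv; rewrite QformC in Q0.
  apply: (rigid_ideal_vanishes hn hrank hpos hp X0 Y'0 Q0);
    exact: in_cone_partial.
have [j1 [k1 [jk1 uj1 uk1 r1]]] := cone_over_rank1 ru.
have [j2 [k2 [jk2 vj2 vk2 r2]]] := cone_over_rank1 rv.
have [i1 [c c0 E1]] := pair_wedge X0 hX uj1 uk1 r1.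
have [i2 [d d0 E2]] := pair_wedge Y0 hY vj2 vk2 r2.
have : reval (octic A j1 k1 j2 k2 i1 i1 i2 i2) (col_mx u v) = 0.
  by apply: hoct; exists j1, k1, j2, k2, i1, i1, i2, i2.
rewrite octic_eval E1 E2 Tform_scale4 ?pnatr_eq0 // => /eqP.
rewrite !mulf_eq0 (negPf c0) (negPf d0) /= => /eqP Q0.
apply: (rigid_ideal_vanishes hn hrank hpos hp X0 Y0 Q0); exact: in_cone_partial.
Qed.

End RigidZeros.


(** * Wedges of matrices with a known kernel vector *)

Section Wedge5Kernel.
Variable F : fieldType.

(** If the wedge is nonzero, some 5 x 5 minor, omitting column k, is nonzero. Kernel vectors are
    then determined by their entry k, so the kernel is a line. *)
Lemma wedge5_kernel (M : 'M[F]_(5, 6)) (z : 'cV_6) : z != 0 -> M *m z = 0 ->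
  exists c, wedge5 M = c *: z.
Proof.
move=> z0 Mz; have [->|/cV0Pn[k]] := eqVneq (wedge5 M) 0.
  by exists 0; rewrite scale0r.
rewrite mxE mulf_eq0 signr_eq0 /= => dk.
have ker (w : 'cV_6) : M *m w = 0 -> w k 0 = 0 -> w = 0.
  move=> Mw wk; have E : col' k M *m row' k w = 0.
    rewrite -Mw; apply/colP => r; rewrite !mxE [RHS](bigD1_ord k) //= wk mulr0 add0r.
    by apply: eq_bigr => j _; rewrite !mxE.
  have E' : row' k w = 0.
    have U : (col' k M : 'M_5) \in unitmx by rewrite unitmxE unitfE.
    by rewrite -[LHS](mulKmx U) E mulmx0.
  apply/colP => r; rewrite [RHS]mxE; have [j ->|->//] := unliftP k r.
  by have := congr1 (fun N : 'cV_5 => N j 0) E'; rewrite !mxE.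
have zk : z k 0 != 0 by apply: contraNneq z0 => zk; rewrite (ker z).
exists (wedge5 M k 0 / z k 0); apply/eqP; rewrite -subr_eq0; apply/eqP.
apply: ker; first by rewrite mulmxBr -scalemxAr Mz scaler0 mulmx_wedge5 subr0.
by rewrite [LHS]mxE [X in _ + X]mxE [X in _ - X]mxE divfK ?subrr.
Qed.

End Wedge5Kernel.

(** * Descent from complex to real coefficients *)

Section RealAndImaginaryParts.
Variables (R : realType) (N : nat).
Notation C := R[i].
Local Notation rc := (real_complex R).
Local Notation ii := (Complex 0 1 : C).

Lemma mpoly_complexE (g : {mpoly C[N]}) : exists c d : {mpoly R[N]},
  g = map_mpoly rc c + ii%:MP * map_mpoly rc d.
Proof.
exists (\sum_(m <- msupp g) complex.Re g@_m *: 'X_[m]).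
exists (\sum_(m <- msupp g) complex.Im g@_m *: 'X_[m]).
rewrite {1}[g]mpolyE !rmorph_sum mulr_sumr -big_split; apply: eq_bigr => m _ /=.
rewrite !map_mpolyZ !map_mpolyX mul_mpolyC scalerA -scalerDl.
by rewrite {1}[g@_m]complexE.
Qed.

Lemma mcoeff_map_real m (q : {mpoly R[N]}) : (map_mpoly rc q)@_m = rc q@_m.
Proof. exact: mcoeff_map_mpoly. Qed.

Lemma mpoly_complex_inj (a b : {mpoly R[N]}) (p : {mpoly R[N]}) :
  map_mpoly rc p = map_mpoly rc a + ii%:MP * map_mpoly rc b -> p = a.
Proof.
move=> E; apply/mpolyP => m.
have : rc p@_m = rc a@_m + ii * rc b@_m.
  rewrite -!mcoeff_map_real E; move: (map_mpoly rc a) (map_mpoly rc b) => a' b'.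
  by rewrite mcoeffD mcoeffCM.
by move/(congr1 (@complex.Re R)); rewrite /= !mul0r !mulr0 subrr addr0.
Qed.

(* The extension of a real ideal to complex coefficients consists of a + i b  *)
(* with a and b in the ideal.                                                 *)
Lemma real_nullstellensatz (I : {mpoly R[N]} -> Prop) (p : {mpoly R[N]}) :
  is_ideal I ->
  (forall b : 'I_N -> C, (forall f, I f -> (map_mpoly rc f).@[b] = 0) ->
     (map_mpoly rc p).@[b] = 0) ->
  exists d : nat, I (p ^+ d).
Proof.
move=> idI van.
pose J (g : {mpoly C[N]}) := exists a b, [/\ I a, I b
  & g = map_mpoly rc a + ii%:MP * map_mpoly rc b].
have i2 : ii%:MP_[N] * ii%:MP = - 1.
  rewrite -mpolyCM -mpolyC1 -mpolyCN; congr mpolyC; apply/eqP.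
  by rewrite eq_complex /= !mul0r !mulr0 mulr1 sub0r addr0 oppr0 !eqxx.
have idJ : is_ideal J.
  have [I0 _ _] := idI; split.
  - by exists 0, 0; split => //; rewrite !rmorph0 mulr0 addr0.
  - move=> _ _ [a [b [Ia Ib ->]]] [c [d [Ic Id ->]]].
    exists (a + c), (b + d); split; [exact: idealD|exact: idealD|].
    rewrite [map_mpoly rc (a + c)]rmorphD [map_mpoly rc (b + d)]rmorphD /=.
    move: (map_mpoly rc a) (map_mpoly rc b) (map_mpoly rc c) (map_mpoly rc d).
    by move: (ii%:MP) => e a' b' c' d'; rewrite mulrDr addrACA.
  - move=> g _ [a [b [Ia Ib ->]]]; have [c [d ->]] := mpoly_complexE g.
    exists (c * a - d * b), (c * b + d * a); split.
    + by apply: idealB => //; exact: idealMl.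
    + by apply: idealD => //; exact: idealMl.
    rewrite [map_mpoly rc (c * a - d * b)]rmorphB [map_mpoly rc (c * b + d * a)]rmorphD /=.
    rewrite !(rmorphM (map_mpoly rc)) /=.
    move: (map_mpoly rc a) (map_mpoly rc b) (map_mpoly rc c) (map_mpoly rc d) i2.
    move: (ii%:MP) => e a' b' c' d' i2.
    have -> : (c' + e * d') * (a' + e * b')
        = c' * a' + e * e * (d' * b') + e * (c' * b' + d' * a') by ring.
    by rewrite i2 mulN1r.
have [|d [a [b [Ia _]]]] := nullstellensatz (@complex_uncountable R) (p := map_mpoly rc p) idJ.
  move=> b Jb; apply: van => f If; apply: Jb; exists f, 0.
  by split=> //; [case: idI|rewrite rmorph0 mulr0 addr0].
by rewrite -rmorphXn => /mpoly_complex_inj E; exists d; rewrite E.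
Qed.

End RealAndImaginaryParts.

Section Conjugation.
Variables (R : realType).
Notation C := R[i].
Local Notation rc := (real_complex R).

Lemma reval_conj m (p : {mpoly R[m * 3]}) (w : 'M[C]_(m, 3)) :
  reval p (map_mx conjc w) = conjc (reval p w).
Proof.
rewrite /reval /ceval !mevalE rmorph_sum; apply: eq_bigr => k _.
rewrite rmorphM rmorph_prod mcoeff_map_mpoly; congr (_ * _).
  exact: esym (conjc_real _).
by apply: eq_bigr => i _; rewrite -map_mxvec mxE rmorphXn.
Qed.

(** Conjugating the equation at the conjugate of w gives a(w) - i b(w) = 0, beside a(w) + i b(w) =
    0. *)
Lemma real_imaginary_vanish m (a b : {mpoly R[m * 3]}) (w : 'M[C]_(m, 3)) :
  let g := map_mpoly rc a + (Complex 0 1 : C)%:MP * map_mpoly rc b in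
  ceval g w = 0 -> ceval g (map_mx conjc w) = 0 -> reval a w = 0 /\ reval b w = 0.
Proof.
move=> g; have E w' : ceval (map_mpoly rc a + (Complex 0 1 : C)%:MP * map_mpoly rc b) w'
    = reval a w' + Complex 0 1 * reval b w'.
  rewrite /reval /ceval; move: (map_mpoly rc a) (map_mpoly rc b) => a' b'.
  by rewrite mevalD mevalM mevalC.
rewrite /g !E !reval_conj.
case: (reval a w) (reval b w) => [x y] [z t] /eqP + /eqP.
rewrite !eq_complex /= => /andP[/eqP h1 /eqP h2] /andP[/eqP h3 /eqP h4].
by split; apply/eqP; rewrite eq_complex /=; apply/andP; split; apply/eqP; lra.
Qed.

End Conjugation.


(** * The set-theoretic equality and the radical *)

Section SetTheoreticEquality.
Variables (R : realType) (n : nat) (A : 'I_n -> 'M[R]_(3, 4)).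
Notation C := R[i].
Local Notation pic := (picture A).
Local Notation rc := (real_complex R).
Local Notation Ruv := {mpoly R[(n + n) * 3]}.
Hypothesis hn : (2 <= n)%N.
Hypothesis hrank : forall i, \rank (A i) = 3%N.
Hypothesis hpos : general_position A.

Lemma rigid_idealP (p : Ruv) :
  (forall (X Y : 'cV[C]_4) u v, X != 0 -> Y != 0 -> Qform X Y = 0 ->
     pictures_of A X u -> pictures_of A Y v -> reval p (col_mx u v) = 0) ->
  rigid_ideal A p.
Proof.
move=> h w [_ hw]; apply: hw => w' [X [Y [X0 Y0 Q0 hX hY]]].
by rewrite -[w']vsubmxK; exact: h Q0 hX hY.
Qed.

(** The vector (X, - 1/a, - 1/b) lies in the kernel of the pair matrix, hence of each row deletion.
    The factor c may be 0. *)
Lemma pictures_wedge (X : 'cV[C]_4) u j k i : X != 0 -> pictures_of A X u ->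
  exists c, wedge5_4 (row' i (complex_pair_mx A u j k) : 'M_(5, 6)) = c *: X.
Proof.
move=> X0 hX; have [[_ [a a0 Ea]] [_ [b b0 Eb]]] := (hX j, hX k).
pose z : 'cV[C]_6 := (col_mx X (col_mx (- a^-1)%:M (- b^-1)%:M) : 'cV_(4 + (1 + 1))).
have Bz : complex_pair_mx A u j k *m z = 0.
  rewrite mul_complex_pair_mx Ea Eb !scaleNr !scalerA !mulVf // !scale1r !subrr.
  by rewrite trmx0 col_mx0.
have [||c E] := @wedge5_kernel _ (row' i (complex_pair_mx A u j k) : 'M_(5, 6)) z.
- apply: contra X0 => /eqP/(congr1 (@usubmx C 4 (1 + 1) 1)).
  by rewrite /z col_mxKu linear0 => ->.
- apply/colP => r; rewrite [RHS]mxE.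
  have := congr1 (fun M : 'cV_6 => M (lift i r) 0) Bz; rewrite [X in _ = X]mxE => <-.
  by rewrite !mxE; apply: eq_bigr => s _; rewrite mxE.
exists c; rewrite /wedge5_4 E linearZ /=; congr (_ *: _).
exact: col_mxKu.
Qed.

Lemma octic_rigid p : is_octic A p -> rigid_ideal A p.
Proof.
move=> [j1 [k1 [j2 [k2 [i1 [i2 [i3 [i4 [_ _ ->]]]]]]]]].
apply: rigid_idealP => X Y u v X0 Y0 Q0 hX hY; rewrite octic_eval.
have [c1 ->] := pictures_wedge j1 k1 i1 X0 hX.
have [c2 ->] := pictures_wedge j1 k1 i2 X0 hX.
have [c3 ->] := pictures_wedge j2 k2 i3 Y0 hY.
have [c4 ->] := pictures_wedge j2 k2 i4 Y0 hY.
by rewrite Tform_scale4 ?pnatr_eq0 // Q0 mulr0.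
Qed.

Lemma eval_comp (f : {mpoly R[n * 3]}) (x : 'M[Ruv]_(n, 3)) w :
  reval (f \mPo [tuple mxvec x 0 k | k < n * 3]) w
  = reval f (map_mx (eval_rmorphism w) x).
Proof.
rewrite /reval /ceval map_mpoly_comp; last exact: complexI.
rewrite comp_mpoly_meval; apply: meval_eq => k.
by rewrite tnth_map tnth_mktuple -map_mxvec mxE.
Qed.

Lemma ideal_gen_eval (G : Ruv -> Prop) w :
  (forall g, G g -> reval g w = 0) -> forall p, ideal_gen G p -> reval p w = 0.
Proof.
move=> h _ [d [c [g [Gg ->]]]]; rewrite -eval_rmorphismE rmorph_sum big1 // => k _.
by rewrite rmorphM /= [X in _ * X](h _ (Gg k)) mulr0.
Qed.

Lemma product_ideal_eval u v :
  (forall f, multiview_ideal A f -> reval f u = 0) ->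
  (forall f, multiview_ideal A f -> reval f v = 0) ->
  forall p, product_ideal A p -> reval p (col_mx u v) = 0.
Proof.
move=> hu hv _ [a [b [ha hb ->]]].
have za : reval a (col_mx u v) = 0.
  apply: ideal_gen_eval ha => _ [f hf ->].
  by rewrite eval_comp eval_uvars; exact: hu.
have zb : reval b (col_mx u v) = 0.
  apply: ideal_gen_eval hb => _ [f hf ->].
  by rewrite eval_comp eval_vvars; exact: hv.
rewrite -eval_rmorphismE rmorphD /=.
by rewrite [X in X + _]za [X in _ + X]zb addr0.
Qed.

Lemma ideal_gen_ideal (G : Ruv -> Prop) : is_ideal (ideal_gen G).
Proof.
split.
- by exists 0%N, (fun=> 0), (fun=> 0); split; [case|rewrite big_ord0].
- move=> _ _ [d [c [g [Gg ->]]]] [e [c' [g' [Gg' ->]]]].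
  exists (d + e)%N, (fun i => match split i with inl j => c j | inr j => c' j end).
  exists (fun i => match split i with inl j => g j | inr j => g' j end); split.
    by move=> i; case: (split i).
  rewrite big_split_ord /=; congr (_ + _); apply: eq_bigr => i _.
    by rewrite (unsplitK (inl i : 'I_d + 'I_e)).
  by rewrite (unsplitK (inr i : 'I_d + 'I_e)).
- move=> a _ [d [c [g [Gg ->]]]]; exists d, (fun i => a * c i), g; split=> //.
  by rewrite mulr_sumr; apply: eq_bigr => i _; rewrite mulrA.
Qed.

Lemma ideal_gen_mem (G : Ruv -> Prop) g : G g -> ideal_gen G g.
Proof.
by move=> Gg; exists 1%N, (fun=> 1), (fun=> g); rewrite big_ord1 mul1r.
Qed.

Lemma ideal_add_ideal (I J : Ruv -> Prop) : is_ideal I -> is_ideal J ->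
  is_ideal (ideal_add I J).
Proof.
move=> idI idJ; split.
- by exists 0, 0; split; [case: idI|case: idJ|rewrite addr0].
- move=> _ _ [a [b [Ia Jb ->]]] [c [d [Ic Jd ->]]].
  by exists (a + c), (b + d); split; [exact: idealD|exact: idealD|rewrite addrACA].
- move=> e _ [a [b [Ia Jb ->]]].
  by exists (e * a), (e * b); split; [exact: idealMl|exact: idealMl|rewrite mulrDr].
Qed.

Lemma ideal_addl (I J : Ruv -> Prop) p : is_ideal J -> I p -> ideal_add I J p.
Proof. by case=> J0 _ _ Ip; exists p, 0; rewrite addr0. Qed.

Lemma ideal_addr (I J : Ruv -> Prop) p : is_ideal I -> J p -> ideal_add I J p.
Proof. by case=> I0 _ _ Jp; exists 0, p; rewrite add0r. Qed.

Lemma product_ideal_ideal : is_ideal (product_ideal A).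
Proof. by apply: ideal_add_ideal; exact: ideal_gen_ideal. Qed.

Lemma multiview_ideal_pictures f (X : 'cV[C]_4) u :
  multiview_ideal A f -> X != 0 -> pictures_of A X u -> reval f u = 0.
Proof.
move=> hf X0 hX; apply: hf; split; first exact: pictures_multipoint hX.
by move=> q; apply; exists X.
Qed.

Lemma product_rigid p : product_ideal A p -> rigid_ideal A p.
Proof.
move=> hp; apply: rigid_idealP => X Y u v X0 Y0 Q0 hX hY.
by apply: product_ideal_eval hp => f hf; [exact: multiview_ideal_pictures hX|exact: multiview_ideal_pictures hY].
Qed.

(** J_A is radical, being a vanishing ideal. For the other inclusion the Nullstellensatz ranges over
    all affine points, including those with zero rows; this is why [rigid_zeros] is stated for
    arbitrary matrices. *)
Lemma radical_rigid p :
  ideal_radical (ideal_add (octic_ideal A) (product_ideal A)) p <-> rigid_ideal A p.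
Proof.
split=> [[d [a [b [ha hb E]]]] w hw|hp].
  have za : reval a w = 0.
    by apply: ideal_gen_eval ha => g /octic_rigid; exact.
  have zb : reval b w = 0 by exact: product_rigid hb w hw.
  have : reval (p ^+ d) w = 0.
    rewrite E -eval_rmorphismE rmorphD /=.
    by rewrite [X in X + _]za [X in _ + X]zb addr0.
  rewrite -eval_rmorphismE rmorphXn => /eqP.
  by rewrite expf_eq0 => /andP[_ /eqP].
have idH : is_ideal (octic_ideal A) by exact: ideal_gen_ideal.
have idI := product_ideal_ideal.
apply: real_nullstellensatz; first exact: ideal_add_ideal.
move=> b hb.
pose w : 'M[C]_(n + n, 3) := vec_mx (\row_k b k).
have ev f : (map_mpoly rc f).@[b] = reval f w.
  by apply: meval_eq => k; rewrite /w vec_mxK mxE.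
rewrite ev -[w]vsubmxK; apply: (rigid_zeros hn hrank hpos) => //.
- move=> f hf; have := eval_comp f (uvars R n) w.
  rewrite -{2}[w]vsubmxK eval_uvars => <-; rewrite -ev; apply: hb.
  apply: ideal_addr => //; apply: ideal_addl; first exact: ideal_gen_ideal.
  by apply: ideal_gen_mem; exists f.
- move=> f hf; have := eval_comp f (vvars R n) w.
  rewrite -{2}[w]vsubmxK eval_vvars => <-; rewrite -ev; apply: hb.
  apply: ideal_addr => //; apply: ideal_addr; first exact: ideal_gen_ideal.
  by apply: ideal_gen_mem; exists f.
- move=> f hf; rewrite vsubmxK -ev; apply: hb; apply: ideal_addl => //.
  exact: ideal_gen_mem.
Qed.

Lemma picture_conj j (X : 'cV[C]_4) :
  pic j (map_mx conjc X) = map_mx conjc (pic j X).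
Proof.
rewrite /picture -map_trmx map_mxM; congr ((_ *m _)^T).
by apply/matrixP => r s; rewrite !mxE; exact: esym (conjc_real _).
Qed.

Lemma pictures_conj (X : 'cV[C]_4) u : pictures_of A X u ->
  pictures_of A (map_mx conjc X) (map_mx conjc u).
Proof.
move=> h j; have [hp [a a0 E]] := h j; rewrite picture_conj map_mx_eq0.
split => //; exists (conjc a); first by rewrite conjc_eq0.
by rewrite -map_row E map_mxZ.
Qed.

(** The closure tests complex polynomials, the ideal only real ones. Pictures are stable under
    conjugation, since the cameras are real, so the real and imaginary parts of a vanishing
    polynomial also vanish on them. *)
Lemma multiview_variety_real u : is_multipoint u ->
  (forall f, multiview_ideal A f -> reval f u = 0) -> multiview_variety A u.
Proof.
move=> u0 hu; split=> // g hg; have [c [d Eg]] := mpoly_complexE g.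
have van w X : X != 0 -> pictures_of A X w -> reval c w = 0 /\ reval d w = 0.
  move=> X0 hX; apply: real_imaginary_vanish; rewrite -Eg; apply: hg.
    by exists X.
  by exists (map_mx conjc X); [rewrite map_mx_eq0|exact: pictures_conj].
have zc : reval c u = 0.
  by apply: hu; apply: multiview_idealP => X w X0 hX; case: (van w X X0 hX).
have zd : reval d u = 0.
  by apply: hu; apply: multiview_idealP => X w X0 hX; case: (van w X X0 hX).
rewrite Eg; move: zc zd; rewrite /reval /ceval.
move: (map_mpoly rc c) (map_mpoly rc d) => c' d' zc zd.
by rewrite mevalD mevalM zc zd mulr0 addr0.
Qed.

Lemma zero_locus_rigid u v : zero_locus (rigid_ideal A) (col_mx u v) <->
  [/\ multiview_variety A u, multiview_variety A v
    & forall p, is_octic A p -> reval p (col_mx u v) = 0].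
Proof.
split=> [[w0 hw]|[hu hv hoct]]; last first.
  split.
    move=> r; rewrite -[r]splitK; case: (split r) => j /=.
      by rewrite rowKu; case: hu.
    by rewrite rowKd; case: hv.
  by apply: (rigid_zeros hn hrank hpos) => // f hf; exact: hf.
split; last by move=> p /octic_rigid; exact: hw.
  apply: multiview_variety_real => [j|f hf].
    by have := w0 (lshift n j); rewrite rowKu.
  have := eval_comp f (uvars R n) (col_mx u v); rewrite eval_uvars => <-.
  apply: hw; apply: product_rigid; apply: ideal_addl; first exact: ideal_gen_ideal.
  by apply: ideal_gen_mem; exists f.
apply: multiview_variety_real => [j|f hf].
  by have := w0 (rshift n j); rewrite rowKd.
have := eval_comp f (vvars R n) (col_mx u v); rewrite eval_vvars => <-.
apply: hw; apply: product_rigid; apply: ideal_addr; first exact: ideal_gen_ideal.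
by apply: ideal_gen_mem; exists f.
Qed.

End SetTheoreticEquality.


(** * Multilinear expansion of T, and truncated adjugates *)

Section TformMultilinear.
Variable S : comUnitRingType.
Implicit Types (X Y : 'cV[S]_4).

Lemma Tform_sum (I : Type) (r : seq I) (a : I -> S) (x : I -> 'cV[S]_4) X' Y Y' :
  Tform (\sum_(i <- r) a i *: x i) X' Y Y' = \sum_(i <- r) a i * Tform (x i) X' Y Y'.
Proof.
elim: r => [|i r IH]; last by rewrite !big_cons Tform_linear IH.
by rewrite !big_nil -[X in Tform X](addNr 0) -scaleN1r Tform_linear mulN1r addNr.
Qed.

Lemma Tform_multilinear m1 m2 m3 m4 (a : 'I_m1 -> S) (b : 'I_m2 -> S)
    (c : 'I_m3 -> S) (d : 'I_m4 -> S) x x' y y' :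
  Tform (\sum_i a i *: x i) (\sum_j b j *: x' j)
        (\sum_k c k *: y k) (\sum_l d l *: y' l) =
  \sum_i a i * \sum_j b j * \sum_k c k * \sum_l d l * Tform (x i) (x' j) (y k) (y' l).
Proof.
rewrite Tform_sum; apply: eq_bigr => i _; congr (_ * _).
rewrite Tform_symX Tform_sum; apply: eq_bigr => j _; congr (_ * _).
rewrite Tform_swap Tform_sum; apply: eq_bigr => k _; congr (_ * _).
rewrite Tform_symX Tform_sum; apply: eq_bigr => l _; congr (_ * _).
by rewrite Tform_symX Tform_swap Tform_symX.
Qed.

Lemma Tform_cong (I : S -> Prop) (X1 X2 X3 X4 Z1 Z2 Z3 Z4 : 'cV[S]_4) (a b : S) :
  is_ideal I -> I a -> I b ->
  I (Tform (a *: Z1 + X1) (a *: Z2 + X2) (b *: Z3 + X3) (b *: Z4 + X4)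
     - Tform X1 X2 X3 X4).
Proof.
move=> idI Ia Ib.
have step c Z X X' Y Y' : I c -> I (Tform (c *: Z + X) X' Y Y' - Tform X X' Y Y').
  by move=> Ic; rewrite Tform_linear addrK; exact: idealMr.
apply: (ideal_cong_trans idI (step _ _ _ _ _ _ Ia)).
rewrite Tform_symX [X in _ - X]Tform_symX.
apply: (ideal_cong_trans idI (step _ _ _ _ _ _ Ia)).
rewrite Tform_swap [X in _ - X]Tform_swap.
apply: (ideal_cong_trans idI (step _ _ _ _ _ _ Ib)).
rewrite Tform_symX [X in _ - X]Tform_symX.
exact: step.
Qed.

End TformMultilinear.

Section Adjugate4.
Variable S : comNzRingType.

Definition adj4 (B : 'M[S]_6) : 'M[S]_(4, 6) := usubmx (\adj B : 'M_(4 + 2, 6)).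

Definition left4 (B : 'M[S]_6) : 'M[S]_(6, 4) := lsubmx (B : 'M_(6, 4 + 2)).

Lemma col_adj4 (B : 'M[S]_6) i :
  col i (adj4 B) = (-1) ^+ i *: wedge5_4 (row' i B : 'M_(5, 6)).
Proof.
apply/colP => k; rewrite !mxE /cofactor exprD -mulrA; congr (_ * (_ * \det _)).
by apply/matrixP => r s; rewrite !mxE.
Qed.

Lemma wedge5_4_adj4 (B : 'M[S]_6) i :
  wedge5_4 (row' i B : 'M_(5, 6)) = (-1) ^+ i *: col i (adj4 B).
Proof. by rewrite col_adj4 scalerA -expr2 sqrr_sign scale1r. Qed.

Lemma adj4_left4 (B : 'M[S]_6) : adj4 B *m left4 B = (\det B)%:M.
Proof.
rewrite /adj4 /left4; have := mul_adj_mx B => E.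
apply/matrixP => i j; have := congr1 (fun M : 'M_6 => M (lshift 2 i) (lshift 2 j)) E.
rewrite !mxE => E'; apply: etrans E'.
by apply: eq_bigr => k _; rewrite !mxE.
Qed.

(** [adj4 B] sends the columns of [left4 B] to multiples of the determinant. Modulo the determinant
    its six columns, which are the truncated wedges up to sign, are thus combinations of the two
    columns of [adj4 B *m L]. *)
Lemma adj4_frame (B : 'M[S]_6) L M D' : left4 B *m D' + L *m M = 1%:M ->
  adj4 B = \det B *: D' + (adj4 B *m L : 'M_(4, 2)) *m M.
Proof.
move=> E; rewrite -[LHS]mulmx1 -E mulmxDr !mulmxA adj4_left4 mul_scalar_mx.
by [].
Qed.

Lemma wedge5_4_frame (B : 'M[S]_6) L (M : 'M_(2, 6)) D' i :
  left4 B *m D' + L *m M = 1%:M ->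
  wedge5_4 (row' i B : 'M_(5, 6)) = \det B *: ((-1) ^+ i *: col i D')
    + \sum_(e < 2) ((-1) ^+ i * M e i) *: col e (adj4 B *m L).
Proof.
move=> E; rewrite wedge5_4_adj4 {1}(adj4_frame E); apply/colP => k.
rewrite [X in X = _]mxE [X in _ * X = _]mxE [X in _ * X = _]mxE [X in _ = X]mxE.
rewrite summxE mulrDr; congr (_ + _); first by rewrite !mxE; ring.
rewrite [X in _ * X = _]mxE mulr_sumr; apply: eq_bigr => e _.
by rewrite [X in _ = X]mxE [X in _ = _ * X]mxE; ring.
Qed.

Lemma col_adj4_mul (B : 'M[S]_6) (L : 'M_(6, 2)) e : col e (adj4 B *m L) =
  \sum_(i < 6) ((-1) ^+ i * L i e) *: wedge5_4 (row' i B : 'M_(5, 6)).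
Proof.
apply/colP => k; rewrite summxE [X in X = _]mxE [X in X = _]mxE.
apply: eq_bigr => i _; rewrite [X in _ = X]mxE mulrAC.
by have := congr1 (fun M : 'cV_4 => M k 0) (col_adj4 B i); rewrite [X in X = _]mxE [X in _ = X]mxE => ->.
Qed.

End Adjugate4.

Section Frame.
Variable F : fieldType.

(** Elimination makes D the first four columns of an invertible [Cb], up to an invertible right
    factor. L consists of the last two columns of [Cb], and M of the last two rows of its
    inverse. *)
Lemma left_frame (D : 'M[F]_(6, 4)) : \rank D = 4%N ->
  exists L : 'M_(6, 2), exists M : 'M_(2, 6), exists D' : 'M_(4, 6),
    [/\ D *m D' + L *m M = 1%:M, M *m D = 0 & M *m L = 1%:M].
Proof.
move=> rD; pose Cb : 'M_(6, 4 + 2) := col_ebase D.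
pose Ci : 'M_(4 + 2, 6) := invmx (col_ebase D).
have CCi : Cb *m Ci = 1%:M by exact: mulmxV (col_ebase_unit D).
have CiC : Ci *m Cb = 1%:M by exact: mulVmx (col_ebase_unit D).
have ED : D = lsubmx Cb *m row_ebase D.
  have E1 : Cb *m (col_mx 1%:M 0 : 'M_(4 + 2, 4)) = lsubmx Cb.
    by rewrite -{1}[Cb]hsubmxK mul_row_col mulmx0 addr0 mulmx1.
  rewrite -E1 -{1}[D]mulmx_ebase rD; congr (_ *m _ *m _).
  apply/matrixP => r s; rewrite -[r](@splitK 4 2); case: (split _) => k /=.
    by rewrite [RHS]col_mxEu !mxE /= ltn_ord andbT.
  by rewrite [RHS]col_mxEd !mxE /= ltnNge leq_addr andbF.
exists (rsubmx Cb), (dsubmx Ci), (invmx (row_ebase D) *m usubmx Ci); split.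
- rewrite {1}ED mulmxA -[X in X *m _]mulmxA mulmxV ?row_ebase_unit // mulmx1.
  by rewrite -mul_row_col hsubmxK vsubmxK.
- rewrite ED mulmxA -[dsubmx Ci *m _](_ : dlsubmx (Ci *m Cb) = _).
    by rewrite CiC scalar_mx_block block_mxKdl mul0mx.
  by rewrite -[in LHS](vsubmxK Ci) -[in LHS](hsubmxK Cb) mul_col_row block_mxKdl.
- rewrite -[dsubmx Ci *m _](_ : drsubmx (Ci *m Cb) = _).
    by rewrite CiC scalar_mx_block block_mxKdr.
  by rewrite -[in LHS](vsubmxK Ci) -[in LHS](hsubmxK Cb) mul_col_row block_mxKdr.
Qed.

End Frame.


(** * Linear spans modulo an ideal, and symmetric pairs *)

Section LinearSpan.
Variables (K : fieldType) (N : nat).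
Notation S := {mpoly K[N]}.
Implicit Types (G I : S -> Prop).

Lemma linear_span_mem G g : G g -> linear_span G g.
Proof. by move=> Gg; exists 1%N, (fun=> 1), (fun=> g); rewrite big_ord1 scale1r. Qed.

Lemma linear_spanZ G a p : linear_span G p -> linear_span G (a *: p).
Proof.
move=> [d [c [g [Gg ->]]]]; exists d, (fun i => a * c i), g; split=> //.
by rewrite scaler_sumr; apply: eq_bigr => i _; rewrite scalerA.
Qed.

Lemma linear_spanD G p q : linear_span G p -> linear_span G q -> linear_span G (p + q).
Proof.
move=> [d [c [g [Gg ->]]]] [e [c' [g' [Gg' ->]]]].
exists (d + e)%N, (fun i => match split i with inl j => c j | inr j => c' j end).
exists (fun i => match split i with inl j => g j | inr j => g' j end); split.
  by move=> i; case: (split i).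
rewrite big_split_ord /=; congr (_ + _); apply: eq_bigr => i _.
  by rewrite (unsplitK (inl i : 'I_d + 'I_e)).
by rewrite (unsplitK (inr i : 'I_d + 'I_e)).
Qed.

Lemma linear_span_sum G (I : Type) (r : seq I) (F : I -> S) :
  (forall i, linear_span G (F i)) -> linear_span G (\sum_(i <- r) F i).
Proof.
move=> h; apply: (big_ind (linear_span G)) => //; last exact: linear_spanD.
by exists 0%N, (fun=> 0), (fun=> 0); split; [case|rewrite big_ord0].
Qed.

Lemma span_dim_mod_fintype I G d (T : finType) (b : T -> S) : #|T| = d ->
  (forall t, linear_span G (b t)) ->
  (forall c : T -> K, I (\sum_t c t *: b t) -> forall t, c t = 0) ->
  (forall g, G g -> exists c : T -> K, I (g - \sum_t c t *: b t)) ->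
  span_dim_mod I G d.
Proof.
move=> <- span free gen; exists (fun i => b (enum_val i)).
have reindexE (c : 'I_#|T| -> K) : \sum_(i < #|T|) c i *: b (enum_val i)
    = \sum_t c (enum_rank t) *: b t.
  rewrite (reindex_onto (@enum_rank T) (fun i => enum_val i)) => [|i _]; last first.
    exact: enum_valK.
  by apply: eq_big => [t|t _]; rewrite enum_rankK ?eqxx.
split=> [i|c Ic i|g /gen[c Ic]]; first exact: span.
  by rewrite -(enum_valK i); apply: free (fun t => c (enum_rank t)) _ _; rewrite -reindexE.
exists (fun i => c (enum_val i)); rewrite reindexE.
by under eq_bigr => t _ do rewrite enum_rankK.
Qed.

End LinearSpan.

Section SymmetricPairs.
Variable S : comNzRingType.

(** Enumerates (0,0), (0,1), (1,1), a basis of Sym_2 of a plane; [sym_coef] gives the coordinates of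
    a product in it. *)
Definition sym_pair (s : 'I_3) : 'I_2 * 'I_2 :=
  (if s == 2 then 1 else 0, if s == 0 then 0 else 1).

Definition sym_coef (a b : 'I_2 -> S) (s : 'I_3) : S :=
  if s == 0 then a 0 * b 0 else if s == 2 then a 1 * b 1 else a 0 * b 1 + a 1 * b 0.

Lemma sum_sym_pair (a b : 'I_2 -> S) (f : 'I_2 -> 'I_2 -> S) :
  f 0 1 = f 1 0 ->
  \sum_e a e * \sum_e' b e' * f e e' =
  \sum_s sym_coef a b s * f (sym_pair s).1 (sym_pair s).2.
Proof.
have sum2 (F : 'I_2 -> S) : \sum_e F e = F 0 + F 1.
  by rewrite big_ord_recl big_ord1; congr (F _ + F _); exact: val_inj.
have sum3 (F : 'I_3 -> S) : \sum_s F s = F 0 + F 1 + F 2.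
  rewrite !big_ord_recl big_ord0 addr0 addrA.
  by congr (F _ + F _ + F _); exact: val_inj.
by move=> f01; rewrite !sum2 sum3 /sym_coef /sym_pair /= f01; ring.
Qed.

End SymmetricPairs.


(** * Nine spanning octics for each choice of two pairs *)

Section OcticSpan.
Variables (R : realType) (n : nat) (A : 'I_n -> 'M[R]_(3, 4)).
Notation C := R[i].
Local Notation pic := (picture A).
Local Notation rc := (real_complex R).
Local Notation Ruv := {mpoly R[(n + n) * 3]}.
Local Notation cst := (@mpolyC ((n + n) * 3) R).
Hypothesis hn : (2 <= n)%N.
Hypothesis hrank : forall i, \rank (A i) = 3%N.
Hypothesis hpos : general_position A.

Local Notation P := {x : 'I_n * 'I_n | (x.1 < x.2)%N}.

Lemma card_camera_pair : #|{: P}| = 'C(n, 2).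
Proof.
rewrite card_sig -bin2_sum -sum1_card big_mkord.
rewrite -(pair_big_dep xpredT (fun i j : 'I_n => (i < j)%N) (fun _ _ => 1%N)) /=.
rewrite (exchange_big_dep xpredT) //=; apply: eq_bigr => j _.
rewrite sum1_card; have jn := ltnW (ltn_ord j).
transitivity #|[set widen_ord jn i | i : 'I_j]|.
  apply: eq_card => i; rewrite [LHS]unfold_in; apply/idP/imsetP => [ij|[k _ ->]]; last exact: (ltn_ord k).
  by exists (Ordinal ij) => //; exact: val_inj.
by rewrite card_imset ?card_ord // => k l /(congr1 val) /= /val_inj.
Qed.

Definition pair_left (p : P) : 'M[R]_(6, 4) :=
  col_mx (A (val p).1) (A (val p).2) : 'M_(3 + 3, 4).

Variables (L : P -> 'M[R]_(6, 2)) (M : P -> 'M[R]_(2, 6)) (D' : P -> 'M[R]_(4, 6)).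
Hypothesis frameE : forall p, pair_left p *m D' p + L p *m M p = 1%:M.

Definition frame_vec (x : 'M[Ruv]_(n, 3)) (p : P) e : 'cV[Ruv]_4 :=
  col e (adj4 (pair_mx A x (val p).1 (val p).2) *m map_mx cst (L p)).

Definition basis_octic (t : (P * P) * ('I_3 * 'I_3)) : Ruv :=
  Tform (frame_vec (uvars R n) t.1.1 (sym_pair t.2.1).1)
        (frame_vec (uvars R n) t.1.1 (sym_pair t.2.1).2)
        (frame_vec (vvars R n) t.1.2 (sym_pair t.2.2).1)
        (frame_vec (vvars R n) t.1.2 (sym_pair t.2.2).2).

Lemma basis_octic_span t : linear_span (is_octic A) (basis_octic t).
Proof.
case: t => [[p q] [s1 s2]]; rewrite /basis_octic /frame_vec /= !col_adj4_mul.
rewrite Tform_multilinear.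
have sgn i a : (-1) ^+ i * cst a = cst ((-1) ^+ i * a).
  by rewrite mpolyCM rmorph_sign.
apply: linear_span_sum => i1; rewrite mxE sgn mul_mpolyC; apply: linear_spanZ.
apply: linear_span_sum => i2; rewrite mxE sgn mul_mpolyC; apply: linear_spanZ.
apply: linear_span_sum => i3; rewrite mxE sgn mul_mpolyC; apply: linear_spanZ.
apply: linear_span_sum => i4; rewrite mxE sgn mul_mpolyC; apply: linear_spanZ.
apply: linear_span_mem.
exists (val p).1, (val p).2, (val q).1, (val q).2, i1, i2, i3, i4.
by split; [exact: (valP p)|exact: (valP q)|].
Qed.

Lemma complex_pair_det0 u j k (X : 'cV[C]_4) (a b : C) : X != 0 ->
  pic j X = a *: row j u -> pic k X = b *: row k u ->
  \det (complex_pair_mx A u j k) = 0.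
Proof.
move=> X0 Ea Eb; rewrite -det_tr; apply/eqP/det0P.
pose z : 'cV[C]_6 := (col_mx X (col_mx (- a)%:M (- b)%:M) : 'cV_(4 + (1 + 1))).
exists z^T.
  rewrite -(inj_eq trmx_inj) trmxK trmx0.
  apply: contra X0 => /eqP/(congr1 (@usubmx C 4 (1 + 1) 1)).
  by rewrite /z col_mxKu linear0 => ->.
rewrite -trmx_mul -[RHS]trmx0; congr (_^T).
by rewrite mul_complex_pair_mx Ea Eb !scaleNr !subrr trmx0 col_mx0.
Qed.

Lemma pair_det_multiview j k (x : 'M[Ruv]_(n, 3)) :
  multiview_ideal_in A x (\det (pair_mx A x j k)).
Proof.
pose vars : 'M[{mpoly R[n * 3]}]_(n, 3) := \matrix_(i, r) 'X_(mxvec_index i r).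
pose f := \det (generic_pair_mx A (@mpolyC (n * 3) R) vars j k).
apply: ideal_gen_mem; exists f.
  apply: multiview_idealP => X u X0 hX.
  rewrite -eval_rmorphismE -det_map_mx.
  have -> : map_mx (eval_rmorphism u) (generic_pair_mx A (@mpolyC (n * 3) R) vars j k)
      = complex_pair_mx A u j k.
    rewrite (@map_generic_pair_mx R n A _ _ _ _ rc); last by move=> a; exact: revalC.
    congr (generic_pair_mx _ _ _ _ _).
    by apply/matrixP => r s; rewrite !mxE; exact: revalX_index.
  have [[_ [a a0 Ea]] [_ [b b0 Eb]]] := (hX j, hX k).
  apply: (complex_pair_det0 X0 (a := a^-1) (b := b^-1)).
    by rewrite Ea scalerA mulVf // scale1r.
  by rewrite Eb scalerA mulVf // scale1r.
rewrite -det_map_mx; congr (\det _).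
rewrite (@map_generic_pair_mx R n A _ _ _ _ cst); last by move=> a; exact: comp_mpolyC.
congr (generic_pair_mx _ _ _ _ _).
apply/matrixP => r s; rewrite !mxE; apply: esym; apply: etrans (comp_mpolyXU _ _) _.
by rewrite -tnth_nth tnth_mktuple mxvecE.
Qed.

Lemma left4_pair_mx (x : 'M[Ruv]_(n, 3)) p :
  left4 (pair_mx A x (val p).1 (val p).2) = map_mx cst (pair_left p).
Proof.
apply/matrixP => r s; rewrite [LHS]mxE [RHS]mxE /pair_mx /pair_left.
rewrite -[r](@splitK 3 3); case: (split _) => k /=.
  apply: etrans (@col_mxEu Ruv 3 3 (4 + 2) _ _ k (lshift 2 s)) _.
  apply: etrans (@row_mxEl Ruv 3 4 2 _ _ k s) _; rewrite mxE; congr cst.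
  exact: esym (@col_mxEu R 3 3 4 _ _ k s).
apply: etrans (@col_mxEd Ruv 3 3 (4 + 2) _ _ k (lshift 2 s)) _.
apply: etrans (@row_mxEl Ruv 3 4 2 _ _ k s) _; rewrite mxE; congr cst.
exact: esym (@col_mxEd R 3 3 4 _ _ k s).
Qed.

(** By [wedge5_4_frame] each argument of T is a combination of two frame vectors plus a multiple of
    a determinant in the product ideal. Multilinearity gives 2^4 terms, and the two symmetries of T
    leave 3 * 3. *)
Lemma octic_mod_basis g : is_octic A g -> exists c : (P * P) * ('I_3 * 'I_3) -> R,
  product_ideal A (g - \sum_t c t *: basis_octic t).
Proof.
move=> [j1 [k1 [j2 [k2 [i1 [i2 [i3 [i4 [jk1 jk2 ->]]]]]]]]].
pose p : P := exist _ (j1, k1) jk1; pose q : P := exist _ (j2, k2) jk2.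
pose mu p' i (e : 'I_2) : R := (-1) ^+ nat_of_ord (i : 'I_6) * M p' e i.
pose c (t : (P * P) * ('I_3 * 'I_3)) : R := if t.1 == (p, q) then
  sym_coef (mu p i1) (mu p i2) t.2.1 * sym_coef (mu q i3) (mu q i4) t.2.2 else 0.
exists c.
have frame x p' i : wedge5_4 (row' i (pair_mx A x (val p').1 (val p').2) : 'M_(5, 6))
  = \det (pair_mx A x (val p').1 (val p').2) *: ((-1) ^+ i *: col i (map_mx cst (D' p')))
    + \sum_(e < 2) cst (mu p' i e) *: frame_vec x p' e.
  rewrite (wedge5_4_frame (L := map_mx cst (L p')) (M := map_mx cst (M p'))
    (D' := map_mx cst (D' p'))).
    congr (_ + _); apply: eq_bigr => e _; congr (_ *: _).
    by rewrite mxE mpolyCM rmorph_sign.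
  by rewrite left4_pair_mx -!map_mxM -map_mxD frameE map_mx1.
have idI := product_ideal_ideal A.
have detu : product_ideal A (\det (pair_mx A (uvars R n) j1 k1)).
  by apply: ideal_addl; [exact: ideal_gen_ideal|exact: pair_det_multiview].
have detv : product_ideal A (\det (pair_mx A (vvars R n) j2 k2)).
  by apply: ideal_addr; [exact: ideal_gen_ideal|exact: pair_det_multiview].
have -> : \sum_t c t *: basis_octic t = Tform
    (\sum_(e < 2) cst (mu p i1 e) *: frame_vec (uvars R n) p e)
    (\sum_(e < 2) cst (mu p i2 e) *: frame_vec (uvars R n) p e)
    (\sum_(e < 2) cst (mu q i3 e) *: frame_vec (vvars R n) q e)
    (\sum_(e < 2) cst (mu q i4 e) *: frame_vec (vvars R n) q e).
  pose F s1 s2 := basis_octic ((p, q), (s1, s2)).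
  transitivity (\sum_s1 cst (sym_coef (mu p i1) (mu p i2) s1)
      * \sum_s2 cst (sym_coef (mu q i3) (mu q i4) s2) * F s1 s2).
    rewrite -(pair_bigA _ (fun pq ss => c (pq, ss) *: basis_octic (pq, ss))) /=.
    rewrite (bigD1 (p, q)) //= [X in _ + X]big1 ?addr0 => [|pq pqne]; last first.
      by apply: big1 => ss _; rewrite /c (negPf pqne) scale0r.
    rewrite -(pair_bigA _ (fun s1 s2 => c ((p, q), (s1, s2)) *: F s1 s2)) /=.
    apply: eq_bigr => s1 _; rewrite mulr_sumr; apply: eq_bigr => s2 _.
    by rewrite /c eqxx /= mulrA -mpolyCM mul_mpolyC.
  have sym_cst a b s : cst (sym_coef a b s) = sym_coef (cst \o a) (cst \o b) s.
    by rewrite /sym_coef /=; do 2?case: ifP => _; rewrite ?mpolyCD !mpolyCM.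
  rewrite Tform_multilinear.
  under eq_bigr => s1 _ do under eq_bigr => s2 _ do rewrite sym_cst.
  under eq_bigr => s1 _ do rewrite sym_cst.
  pose G e1 e2 e3 e4 := Tform (frame_vec (uvars R n) p e1) (frame_vec (uvars R n) p e2)
    (frame_vec (vvars R n) q e3) (frame_vec (vvars R n) q e4).
  have Gsym1 e3 e4 : G 0 1 e3 e4 = G 1 0 e3 e4 by rewrite /G Tform_symX.
  have Gsym e1 e2 : G e1 e2 0 1 = G e1 e2 1 0.
    rewrite /G Tform_swap Tform_symX; exact: Tform_swap.
  rewrite -(sum_sym_pair (cst \o mu p i1) (cst \o mu p i2) (f := fun e1 e2 =>
    \sum_s2 sym_coef (cst \o mu q i3) (cst \o mu q i4) s2
      * G e1 e2 (sym_pair s2).1 (sym_pair s2).2)).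
    apply: eq_bigr => e1 _; congr (_ * _); apply: eq_bigr => e2 _; congr (_ * _).
    exact: esym (sum_sym_pair (cst \o mu q i3) (cst \o mu q i4) (Gsym e1 e2)).
  by apply: eq_bigr => s2 _; rewrite Gsym1.
rewrite /octic (frame _ p i1) (frame _ p i2) (frame _ q i3) (frame _ q i4).
exact: Tform_cong.
Qed.

End OcticSpan.


(** * Adjugates of rank one, and quadratic forms *)

Section AdjugateRankOne.
Variable F : fieldType.

Lemma col_adj (B : 'M[F]_6) i :
  col i (\adj B) = (-1) ^+ i *: wedge5 (row' i B : 'M_(5, 6)).
Proof.
apply/colP => k; rewrite !mxE /cofactor exprD -mulrA; congr (_ * (_ * \det _)).
by apply/matrixP => r s; rewrite !mxE.
Qed.

(** Every column of the adjugate is, up to sign, a wedge and so a multiple of z. Then z r B = det B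
    = 0 forces r B = 0. *)
Lemma adj_rank1 (B : 'M[F]_6) (z : 'cV_6) : z != 0 -> B *m z = 0 ->
  exists r : 'rV_6, [/\ \adj B = z *m r, r *m B = 0
    & (forall z', B *m z' = 0 -> exists c, z' = c *: z) -> r != 0].
Proof.
move=> z0 Bz.
have /choice[c hc] : forall i, exists c, wedge5 (row' i B : 'M_(5, 6)) = c *: z.
  move=> i; apply: wedge5_kernel => //; apply/colP => r; rewrite [RHS]mxE.
  have := congr1 (fun N : 'cV_6 => N (lift i r) 0) Bz; rewrite [X in _ = X]mxE => <-.
  by rewrite !mxE; apply: eq_bigr => s _; rewrite mxE.
pose r : 'rV_6 := \row_i ((-1) ^+ i * c i).
have E : \adj B = z *m r.
  apply/matrixP => k i; have := congr1 (fun N : 'cV_6 => N k 0) (col_adj B i).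
  rewrite [X in X = _]mxE hc => ->.
  by rewrite [RHS]mxE big_ord1 ![in LHS]mxE [r 0 i]mxE; ring.
have dB : \det B = 0.
  rewrite -det_tr; apply/eqP/det0P; exists z^T.
    by rewrite -(inj_eq trmx_inj) trmxK trmx0.
  by rewrite -trmx_mul Bz trmx0.
have /cV0Pn[k zk] := z0.
exists r; split=> // [|ker].
  apply/rowP => s; rewrite [RHS]mxE; have := mul_adj_mx B; rewrite E dB -mulmxA.
  move/(congr1 (fun N : 'M_6 => N k s)); rewrite [X in X = _ -> _]mxE [X in _ = X -> _]mxE.
  rewrite big_ord1 mul0rn => /eqP.
  by rewrite mulf_eq0 (negPf zk) => /eqP.
have [i [d d0 Ed]] := wedge5_corank1 z0 Bz ker.
apply: contraNneq d0 => r0; have := congr1 (fun N : 'rV_6 => N 0 i) r0.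
rewrite !mxE => /eqP; rewrite mulf_eq0 signr_eq0 /= => /eqP ci.
by move: Ed; rewrite hc ci scale0r => /esym/eqP; rewrite scaler_eq0 (negPf z0) orbF.
Qed.

Lemma quadratic_forms_free (d : 'I_3 -> F) :
  (forall a : 'I_2 -> F, \sum_s d s * (a (sym_pair s).1 * a (sym_pair s).2) = 0) ->
  forall s, d s = 0.
Proof.
move=> h.
have E (a : 'I_2 -> F) : d 0 * (a 0 * a 0) + d 1 * (a 0 * a 1) + d 2 * (a 1 * a 1) = 0.
  rewrite -[RHS](h a) !big_ord_recl big_ord0 addr0 addrA /sym_pair /=.
  by congr (d _ * _ + d _ * _ + d _ * _); exact: val_inj.
have d0 : d 0 = 0 by have := E (fun e => (e == 0)%:R); rewrite /= !mulr1 !mulr0 !addr0.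
have d2 : d 2 = 0 by have := E (fun e => (e == 1)%:R); rewrite /= !mulr1 !mulr0 !add0r.
have d1 : d 1 = 0 by have := E (fun=> 1); rewrite d0 d2 !mulr1 addr0 add0r.
by case=> [[|[|[|//]]] ls]; [rewrite -[RHS]d0|rewrite -[RHS]d1|rewrite -[RHS]d2];
  congr d; exact: val_inj.
Qed.

End AdjugateRankOne.

(** * Linear independence of the nine octics *)

Section MultiviewCone.
Variables (R : realType) (n : nat) (A : 'I_n -> 'M[R]_(3, 4)).
Notation C := R[i].
Local Notation pic := (picture A).
Hypothesis hn : (2 <= n)%N.
Hypothesis hrank : forall i, \rank (A i) = 3%N.

(** Zero factors and focal points are allowed: for generic X and factors these are genuine pictures,
    and vanishing extends by density. *)
Lemma multiview_cone f (X : 'cV[C]_4) (a : 'I_n -> C) :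
  multiview_ideal A f -> reval f (\matrix_l (a l *: pic l X)) = 0.
Proof.
move=> hf; pose vec (x : 'I_(4 + n) -> C) : 'cV_(4 + n) := \col_k x k.
pose X' x := usubmx (vec x); pose a' x l : C := dsubmx (vec x) l 0.
pose pt Z (b : 'I_n -> C) : 'I_(4 + n) -> C := fun k => col_mx Z (\col_l b l) k 0.
have vecK Z b : vec (pt Z b) = col_mx Z (\col_l b l) by apply/colP => k; rewrite mxE.
have XK Z b : X' (pt Z b) = Z by rewrite /X' vecK col_mxKu.
have aK Z b l : a' (pt Z b) l = b l by rewrite /a' vecK col_mxKd mxE.
have pX : polymx X'.
  by move=> k l; apply: polyfun_ext (polyfun_var _ (lshift n k)) => x; rewrite !mxE.
have pa l : polyfun (fun x => a' x l).
  by apply: polyfun_ext (polyfun_var _ (rshift 4 l)) => x; rewrite /a' !mxE.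
have unc := @complex_uncountable R.
have -> : \matrix_l (a l *: pic l X) =
    \matrix_l (a' (pt X a) l *: pic l (X' (pt X a))).
  by apply/row_matrixP => l; rewrite !rowK XK aK.
apply: (polyfun_generic unc
  (f := fun x => reval f (\matrix_l (a' x l *: pic l (X' x))))
  (g := fun x => \prod_l (a' x l * pic l (X' x) 0 0))).
- apply: polyfun_reval; apply: polymx_rows => l; apply: polymxZ => //.
  exact: polymx_picture.
- apply: (nzpolyfun_prod unc) => l; apply: (nzpolyfunM unc); split.
  + exact: pa.
  + by exists (pt 0 (fun=> 1)); rewrite aK oner_neq0.
  + exact: polymx_picture.
  + have [Z E] := picture_surj hrank l (const_mx 1).
    by exists (pt Z (fun=> 0)); rewrite XK E mxE oner_neq0.
- move=> x /prodf_neq0 h.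
  have {}h l : a' x l != 0 /\ pic l (X' x) != 0.
    have := h l isT; rewrite mulf_eq0 negb_or => /andP[h1 h2].
    by split=> //; apply: contraNneq h2 => ->; rewrite mxE.
  have l0 : 'I_n := Ordinal (leq_trans (ltnSn 1) hn).
  apply: (multiview_ideal_pictures hf (picture_neq0 (proj2 (h l0)))) => l.
  by have [h1 h2] := h l; split=> //; exists (a' x l); rewrite ?rowK.
Qed.

End MultiviewCone.


Section OcticFree.
Variables (R : realType) (n : nat) (A : 'I_n -> 'M[R]_(3, 4)).
Notation C := R[i].
Local Notation pic := (picture A).
Local Notation rc := (real_complex R).
Hypothesis hn : (2 <= n)%N.
Hypothesis hrank : forall i, \rank (A i) = 3%N.
Hypothesis hpos : general_position A.
Local Notation P := {x : 'I_n * 'I_n | (x.1 < x.2)%N}.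

Variables (L : P -> 'M[R]_(6, 2)) (M : P -> 'M[R]_(2, 6)) (D' : P -> 'M[R]_(4, 6)).
Hypothesis frameE : forall p, pair_left A p *m D' p + L p *m M p = 1%:M.
Hypothesis frameMD : forall p, M p *m pair_left A p = 0.
Hypothesis frameML : forall p, M p *m L p = 1%:M.

Definition complex_frame_vec (u : 'M[C]_(n, 3)) (p : P) e : 'cV[C]_4 :=
  col e (adj4 (complex_pair_mx A u (val p).1 (val p).2) *m map_mx rc (L p)).

(* The class of (0, A_k X) modulo the column space of [A_j; A_k].             *)
Definition frame_coord (p : P) (X : 'cV[C]_4) : 'cV[C]_2 :=
  map_mx rc (M p) *m (col_mx 0 (pic (val p).2 X)^T : 'M_(3 + 3, 1)).

Lemma mul_pair_left (p : P) (X : 'cV[C]_4) :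
  map_mx rc (pair_left A p) *m X =
  (col_mx (pic (val p).1 X)^T (pic (val p).2 X)^T : 'M_(3 + 3, 1)).
Proof.
transitivity (map_mx rc (col_mx (A (val p).1) (A (val p).2)) *m X); first by [].
by rewrite map_col_mx mul_col_mx /picture !trmxK.
Qed.

Lemma pair_neq (p : P) : (val p).1 != (val p).2.
Proof. by apply/eqP => E; have := valP p; rewrite E ltnn. Qed.

Lemma complex_frameMD p : map_mx rc (M p) *m map_mx rc (pair_left A p) = 0.
Proof. by rewrite -map_mxM frameMD map_mx0. Qed.

(** The right half of M has independent rows: if v kills it, v M is supported on the first block,
    where injectivity of v -> v A_j makes it 0, and v = v M L = 0. *)
Lemma frame_coord_surj p (a : 'cV[C]_2) : exists X, frame_coord p X = a.
Proof.
pose M2 : 'M[C]_(2, 3) := rsubmx (map_mx rc (M p) : 'M_(2, 3 + 3)).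
pose M1 : 'M[C]_(2, 3) := lsubmx (map_mx rc (M p) : 'M_(2, 3 + 3)).
have ME : map_mx rc (M p) = row_mx M1 M2 by rewrite hsubmxK.
have coordE X : frame_coord p X = M2 *m (pic (val p).2 X)^T.
  transitivity (row_mx M1 M2 *m col_mx 0 (pic (val p).2 X)^T); first by rewrite -ME.
  by rewrite mul_row_col mulmx0 add0r.
have free : row_free M2.
  apply: inj_row_free => v vM2.
  have vME : v *m map_mx rc (M p) = row_mx (v *m M1) 0.
    transitivity (v *m row_mx M1 M2); first by rewrite -ME.
    by rewrite mul_mx_row vM2.
  have vM1 : v *m M1 = 0.
    have : v *m map_mx rc (M p) *m map_mx rc (pair_left A p) = 0.
      by rewrite -mulmxA complex_frameMD mulmx0.
    rewrite vME => E.
    have {}E : row_mx (v *m M1) 0 *m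
        (col_mx (map_mx rc (A (val p).1)) (map_mx rc (A (val p).2)) : 'M_(3 + 3, 4)) = 0.
      by rewrite -map_col_mx; exact: E.
    move: E; rewrite mul_row_col mul0mx addr0 => E.
    have free1 : row_free (map_mx rc (A (val p).1)) by rewrite /row_free mxrank_map hrank.
    by apply: (row_free_inj free1); rewrite E mul0mx.
  have := vME; rewrite vM1 row_mx0 => /(congr1 (fun N => N *m map_mx rc (L p))).
  by rewrite -mulmxA -map_mxM frameML map_mx1 mulmx1 mul0mx.
have /row_freeP[N MN] := free.
have [X EX] := picture_surj hrank (val p).2 (N *m a)^T.
by exists X; rewrite coordE EX trmxK mulmxA MN mul1mx.
Qed.

(** For nonzero m, this spans the row vectors that annihilate m. *)
Definition coord_perp (m : 'cV[C]_2) (e : 'I_2) : C :=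
  if e == 0 then m 1 0 else - m 0 0.

(** The pair matrix has the kernel vector (0, l, m), and the columns of its adjugate are multiples
    of it, so their first four entries vanish. *)
Lemma complex_frame_vec_eq0 u p e (l m : C) : (l != 0) || (m != 0) ->
  l *: row (val p).1 u = 0 -> m *: row (val p).2 u = 0 ->
  complex_frame_vec u p e = 0.
Proof.
move=> lm El Em.
pose z : 'cV[C]_6 := (col_mx 0 (col_mx l%:M m%:M) : 'cV_(4 + (1 + 1))).
have z0 : z != 0.
  apply/eqP => E; have : col_mx l%:M m%:M = 0 :> 'cV[C]_(1 + 1).
    have := congr1 (@dsubmx C 4 (1 + 1) 1) E; rewrite linear0 => <-.
    by rewrite /z col_mxKd.
  rewrite -col_mx0 => /eq_col_mx[].
  move/(congr1 (fun N : 'M_1 => N 0 0)); rewrite !mxE eqxx mulr1n => l0.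
  move/(congr1 (fun N : 'M_1 => N 0 0)); rewrite !mxE eqxx mulr1n => m0.
  by move: lm; rewrite l0 m0 eqxx.
have Bz : complex_pair_mx A u (val p).1 (val p).2 *m z = 0.
  by rewrite mul_complex_pair_mx !picture0 !add0r El Em trmx0 col_mx0.
have [r [E _ _]] := adj_rank1 z0 Bz.
rewrite /complex_frame_vec /adj4 E.
have -> : usubmx (z *m r : 'M_(4 + 2, 6)) = (usubmx (z : 'cV_(4 + 2)) *m r).
  by apply/matrixP => s t; rewrite !mxE; apply: eq_bigr => k _; rewrite !mxE.
have -> : usubmx (z : 'cV_(4 + 2)) = 0 by exact: col_mxKu.
by rewrite !mul0mx; apply/colP => k; rewrite !mxE.
Qed.

(** Here the adjugate is z r with z = (X, -1, -1) and r nonzero. Since r kills the columns of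
    [A_j; A_k], it factors as (r L) M, and the frame vectors are X times the entries of r L. *)
Lemma complex_frame_vecE u p (X : 'cV[C]_4) :
  row (val p).1 u = pic (val p).1 X -> row (val p).2 u = pic (val p).2 X ->
  frame_coord p X != 0 ->
  exists2 g, g != 0 & forall e,
    complex_frame_vec u p e = (g * coord_perp (frame_coord p X) e) *: X.
Proof.
set j := (val p).1; set k := (val p).2 => Ej Ek m0.
have X0 : X != 0.
  by apply: contraNneq m0 => ->; rewrite /frame_coord picture0 trmx0 col_mx0 mulmx0.
pose B := complex_pair_mx A u j k.
pose z : 'cV[C]_6 := (col_mx X (col_mx (- 1)%:M (- 1)%:M) : 'cV_(4 + (1 + 1))).
have zu : usubmx (z : 'cV_(4 + 2)) = X by exact: col_mxKu.
have z0 : z != 0 by apply: contraNneq X0 => z0; rewrite -zu z0 linear0.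
have Bz : B *m z = 0.
  rewrite mul_complex_pair_mx Ej Ek !scaleN1r !subrr.
  by rewrite trmx0 col_mx0.
have [r [E rB r0]] := adj_rank1 z0 Bz.
have {}r0 : r != 0.
  apply: r0 => z' Bz'; pose w : 'cV[C]_(4 + (1 + 1)) := z'.
  pose Y := usubmx w; pose a := usubmx (dsubmx w) 0 0; pose b := dsubmx (dsubmx w) 0 0.
  have Ew : w = col_mx Y (col_mx a%:M b%:M).
    by rewrite -[LHS]vsubmxK -[dsubmx w]vsubmxK -!mx11_scalar.
  have : B *m w = 0 by exact: Bz'.
  rewrite Ew mul_complex_pair_mx Ej Ek => E0.
  have E1 : col_mx (pic j Y + a *: pic j X)^T (pic k Y + b *: pic k X)^T
      = col_mx 0 0 :> 'M_(3 + 3, 1) by rewrite col_mx0; exact: E0.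
  have [/(congr1 trmx) + /(congr1 trmx)] := eq_col_mx E1.
  rewrite !trmxK !trmx0 => Ea Eb.
  have Eba : (b - a) *: frame_coord p X = 0.
    have : map_mx rc (M p) *m (map_mx rc (pair_left A p) *m (Y + a *: X)) = 0.
      by rewrite mulmxA complex_frameMD mul0mx.
    rewrite mul_pair_left !pictureD !pictureZ Ea.
    have -> : pic k Y + a *: pic k X = (a - b) *: pic k X.
      by rewrite -[LHS]subr0 -Eb opprD addrACA subrr add0r -scalerBl.
    rewrite trmx0 linearZ /= -[X in col_mx X _](scaler0 _ (a - b)) -scale_col_mx.
    by rewrite -scalemxAr -/(frame_coord p X) -[b - a]opprB scaleNr => ->; rewrite oppr0.
  have ba : b = a.
    by move/eqP: Eba; rewrite scaler_eq0 (negPf m0) orbF subr_eq0 => /eqP.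
  have EY : Y = (- a) *: X.
    apply/eqP; rewrite scaleNr -addr_eq0; apply/eqP.
    apply: (picture_inj2 hrank hpos (pair_neq p)); rewrite pictureD pictureZ ?Ea //.
    by rewrite -ba.
  exists (- a); transitivity w; first by [].
  rewrite Ew EY ba; transitivity (- a *: col_mx X (col_mx (- 1)%:M (- 1)%:M)); last by [].
  by rewrite !scale_col_mx !scale_scalar_mx !mulrN mulr1 opprK.
have rD : r *m map_mx rc (pair_left A p) = 0.
  apply/rowP => s; rewrite [RHS]mxE.
  have := congr1 (fun N : 'rV_6 => N 0 (lshift 2 s)) rB; rewrite [X in _ = X]mxE => <-.
  rewrite !mxE; apply: eq_bigr => t _; congr (_ * _).
  rewrite -[t](@splitK 3 3); case: (split _) => t' /=.
    apply: etrans (esym (@col_mxEu C 3 3 (4 + 2) _ _ t' (lshift 2 s))).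
    apply: etrans (esym (@row_mxEl C 3 4 2 _ _ t' s)); rewrite [LHS]mxE [RHS]mxE; congr rc.
    exact: (@col_mxEu R 3 3 4 _ _ t' s).
  apply: etrans (esym (@col_mxEd C 3 3 (4 + 2) _ _ t' (lshift 2 s))).
  apply: etrans (esym (@row_mxEl C 3 4 2 _ _ t' s)); rewrite [LHS]mxE [RHS]mxE; congr rc.
  exact: (@col_mxEd R 3 3 4 _ _ t' s).
pose g : 'rV[C]_2 := r *m map_mx rc (L p).
have rg : r = g *m map_mx rc (M p).
  rewrite /g -[LHS]mulmx1 -(map_mx1 rc) -(frameE p) map_mxD !map_mxM mulmxDr.
  by rewrite mulmxA rD mul0mx add0r mulmxA.
(* The last column of B is (0, A_k X); r kills it, and M maps it to [frame_coord p X]. *)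
have gm : g *m frame_coord p X = 0.
  rewrite /frame_coord mulmxA -rg.
  have : r *m (B *m (col_mx 0 (col_mx 0%:M 1%:M) : 'cV_(4 + (1 + 1)))) = 0.
    by rewrite mulmxA rB mul0mx.
  by rewrite mul_complex_pair_mx !picture0 !add0r scale0r scale1r trmx0 Ek.
have g0 : g != 0 by apply: contraNneq r0 => g0; rewrite rg g0 mul0mx.
pose m := frame_coord p X; pose g1 := g 0 0; pose g2 := g 0 1.
have sum2 (F : 'I_2 -> C) : \sum_e F e = F 0 + F 1.
  by rewrite big_ord_recl big_ord1; congr (F _ + F _); exact: val_inj.
have gm' : g1 * m 0 0 + g2 * m 1 0 = 0.
  by have := congr1 (fun N : 'M_1 => N 0 0) gm;
    rewrite [X in X = _ -> _]mxE [X in _ = X -> _]mxE sum2.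
have two (e : 'I_2) : e = 0 \/ e = 1.
  case: e => [[|[|k']] le]; [left|right|by []]; exact: val_inj.
have [c Ec] : exists c, forall e, g 0 e = c * coord_perp m e.
  have [m00|m00] := eqVneq (m 0 0) 0.
    have m10 : m 1 0 != 0.
      apply: contraNneq m0 => m10; apply/eqP/colP => e; rewrite [RHS]mxE.
      by case: (two e) => ->.
    exists (g1 / m 1 0) => e; have [->|->] := two e; rewrite /coord_perp /=.
      by rewrite divfK.
    rewrite m00 oppr0 mulr0; move/eqP: gm'; rewrite m00 mulr0 add0r.
    by rewrite mulf_eq0 (negPf m10) orbF => /eqP.
  exists (- g2 / m 0 0) => e; have [->|->] := two e; rewrite /coord_perp /=.
    apply: (mulIf m00); rewrite mulrAC divfK // mulNr.
    by apply/eqP; rewrite -addr_eq0; apply/eqP.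
  by rewrite mulrN divfK // opprK.
exists c.
  apply: contraNneq g0 => c0; apply/eqP/rowP => e.
  by rewrite Ec c0 mul0r mxE.
move=> e; rewrite -Ec /complex_frame_vec /adj4 E.
have -> : usubmx (z *m r : 'M_(4 + 2, 6)) = X *m r.
  by rewrite -zu; apply/matrixP => s t; rewrite !mxE; apply: eq_bigr => i _; rewrite !mxE.
rewrite -mulmxA -/g; apply/colP => s.
by rewrite [LHS]mxE [LHS]mxE big_ord1 [RHS]mxE mulrC.
Qed.

End OcticFree.


Section OcticIndependence.
Variables (R : realType) (n : nat) (A : 'I_n -> 'M[R]_(3, 4)).
Notation C := R[i].
Local Notation pic := (picture A).
Local Notation rc := (real_complex R).
Hypothesis hn : (2 <= n)%N.
Hypothesis hrank : forall i, \rank (A i) = 3%N.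
Hypothesis hpos : general_position A.
Local Notation P := {x : 'I_n * 'I_n | (x.1 < x.2)%N}.

Variables (L : P -> 'M[R]_(6, 2)) (M : P -> 'M[R]_(2, 6)) (D' : P -> 'M[R]_(4, 6)).
Hypothesis frameE : forall p, pair_left A p *m D' p + L p *m M p = 1%:M.
Hypothesis frameMD : forall p, M p *m pair_left A p = 0.
Hypothesis frameML : forall p, M p *m L p = 1%:M.

Lemma map_adj4 (S S' : comNzRingType) (f : {rmorphism S -> S'}) (B : 'M[S]_6) :
  map_mx f (adj4 B) = adj4 (map_mx f B).
Proof. by rewrite /adj4 -map_mx_adj; apply/matrixP => r s; rewrite !mxE. Qed.

Lemma eval_frame_vec w (x : 'M[{mpoly R[(n + n) * 3]}]_(n, 3)) p e :
  map_mx (eval_rmorphism w) (frame_vec A L x p e)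
  = complex_frame_vec A L (map_mx (eval_rmorphism w) x) p e.
Proof.
rewrite /frame_vec /complex_frame_vec map_col map_mxM map_adj4 eval_pair_mx.
congr (col _ (_ *m _)); apply/matrixP => r s; rewrite !mxE; exact: revalC.
Qed.

Lemma basis_octic_eval u v t : reval (basis_octic A L t) (col_mx u v) =
  Tform (complex_frame_vec A L u t.1.1 (sym_pair t.2.1).1)
        (complex_frame_vec A L u t.1.1 (sym_pair t.2.1).2)
        (complex_frame_vec A L v t.1.2 (sym_pair t.2.2).1)
        (complex_frame_vec A L v t.1.2 (sym_pair t.2.2).2).
Proof.
have eu p e : map_mx (eval_rmorphism (col_mx u v)) (frame_vec A L (uvars R n) p e)
    = complex_frame_vec A L u p e by rewrite eval_frame_vec eval_uvars.
have ev p e : map_mx (eval_rmorphism (col_mx u v)) (frame_vec A L (vvars R n) p e)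
    = complex_frame_vec A L v p e by rewrite eval_frame_vec eval_vvars.
rewrite -eval_rmorphismE /basis_octic; apply: Tform_map_eq.
- exact: two_unit_mpoly.
- exact: eu.
- exact: eu.
- exact: ev.
- exact: ev.
Qed.

Lemma Tform0 (S : comUnitRingType) (X' Y Y' : 'cV[S]_4) : Tform 0 X' Y Y' = 0.
Proof. by have := Tform_sum (I := nat) [::] (fun=> 0) (fun=> 0) X' Y Y'; rewrite !big_nil. Qed.

Lemma reval_scale m (a : R) (p : {mpoly R[m * 3]}) w :
  reval (a *: p) w = rc a * reval p w.
Proof. by rewrite /reval /ceval map_mpolyZ mevalZ. Qed.

(** All rows outside the pair are 0, which makes the frame vectors of every other pair vanish and
    isolates one block of a linear relation. *)
Definition pair_pictures (p : P) (X : 'cV[C]_4) : 'M[C]_(n, 3) :=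
  \matrix_l (((l == (val p).1) || (l == (val p).2))%:R *: pic l X).

Lemma pair_pictures1 p X : row (val p).1 (pair_pictures p X) = pic (val p).1 X.
Proof. by rewrite rowK eqxx scale1r. Qed.

Lemma pair_pictures2 p X : row (val p).2 (pair_pictures p X) = pic (val p).2 X.
Proof. by rewrite rowK eqxx orbT scale1r. Qed.

Lemma pair_pictures_other (p p' : P) X e : p' != p ->
  complex_frame_vec A L (pair_pictures p X) p' e = 0.
Proof.
move=> pp'.
have [h1|h1] := boolP (((val p').1 == (val p).1) || ((val p').1 == (val p).2)); last first.
  apply: (@complex_frame_vec_eq0 R n A L _ _ _ 1 0); rewrite ?oner_eq0 //.
    by rewrite rowK (negPf h1) scale0r scaler0.
  by rewrite scale0r.
have [h2|h2] := boolP (((val p').2 == (val p).1) || ((val p').2 == (val p).2)); last first.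
  apply: (@complex_frame_vec_eq0 R n A L _ _ _ 0 1); rewrite ?oner_eq0 ?orbT //.
    by rewrite scale0r.
  by rewrite rowK (negPf h2) scale0r scaler0.
exfalso; move: pp' h1 h2; rewrite -val_eqE.
move: (valP p) (valP p'); case: (val p) (val p') => j k [j' k'] /= jk jk'.
move=> pp' /orP[/eqP j'E|/eqP j'E] /orP[/eqP k'E|/eqP k'E]; move: pp' jk'; rewrite j'E k'E.
- by rewrite ltnn.
- by rewrite eqxx.
- by move=> _ kj; have := ltn_trans jk kj; rewrite ltnn.
- by rewrite ltnn.
Qed.

Lemma polymx_frame_coord N p (X : ('I_N -> C) -> 'cV[C]_4) :
  polymx X -> polymx (fun x => frame_coord A M p (X x)).
Proof.
move=> hX e k; apply: (polyfun_ext (f := fun x => \sum_t map_mx rc (M p) e t *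
    (col_mx 0 (pic (val p).2 (X x))^T : 'M_(3 + 3, 1)) t k)).
  by move=> x; rewrite [RHS]mxE.
apply: polyfun_sum => t; apply: polyfunM; first exact: polyfun_cst.
have pc : polymx (fun x => col_mx 0 (pic (val p).2 (X x))^T : 'M_(3 + 3, 1)).
  apply: polymx_col; first exact: polymx_cst.
  move=> r s; apply: polyfun_ext (polymx_picture A (val p).2 hX s r) => x.
  by rewrite [RHS]mxE.
exact: pc.
Qed.

Definition perp_coord (p : P) (X : 'cV[C]_4) := coord_perp (frame_coord A M p X).

Lemma perp_coord_surj p (a : 'I_2 -> C) : exists X, forall e, perp_coord p X e = a e.
Proof.
have [X E] := frame_coord_surj hrank frameMD frameML p
  (\col_(e < 2) if e == 0 then - a 1 else a 0).
exists X => e; rewrite /perp_coord /coord_perp E !mxE /=.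
by case: e => [[|[|k]] le] //=; rewrite ?opprK; congr (a _); exact: val_inj.
Qed.

Lemma polyfun_perp_coord N p (X : ('I_N -> C) -> 'cV[C]_4) e :
  polymx X -> polyfun (fun x => perp_coord p (X x) e).
Proof.
move=> hX; rewrite /perp_coord /coord_perp; case: (e == 0).
  exact: polymx_frame_coord.
by apply: polyfunN; exact: polymx_frame_coord.
Qed.

(** At ([pair_pictures p X], [pair_pictures q Y]) only the block (p, q) survives, as a nonzero
    multiple of Q(X, Y) F when both frame coordinates are nonzero; otherwise F is trivially 0. F is
    biquadratic in the perpendicular coordinates, which take all values, so its coefficients
    vanish. *)
Lemma basis_octic_free (c : (P * P) * ('I_3 * 'I_3) -> R) :
  product_ideal A (\sum_t c t *: basis_octic A L t) -> forall t, c t = 0.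
Proof.
move=> Ic [[p q] [s1 s2]].
pose d t1 t2 := rc (c ((p, q), (t1, t2))).
pose sq (a : 'I_2 -> C) s := a (sym_pair s).1 * a (sym_pair s).2.
pose F (a b : 'I_2 -> C) := \sum_t1 (\sum_t2 d t1 t2 * sq b t2) * sq a t1.
have FQ X Y : Qform X Y != 0 -> F (perp_coord p X) (perp_coord q Y) = 0.
  move=> Q0.
  have perp0 m s : m = 0 -> sq (coord_perp m) s = 0.
    by move=> ->; rewrite /sq /coord_perp !mxE oppr0 !if_same mul0r.
  have [mX|mX] := eqVneq (frame_coord A M p X) 0.
    by rewrite /F big1 // => t1 _; rewrite perp0 ?mulr0.
  have [mY|mY] := eqVneq (frame_coord A M q Y) 0.
    rewrite /F big1 // => t1 _; rewrite [X in X * _]big1 ?mul0r // => t2 _.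
    by rewrite perp0 ?mulr0.
  have [g g0 Eg] := complex_frame_vecE hrank hpos frameE frameMD
    (pair_pictures1 p X) (pair_pictures2 p X) mX.
  have [h h0 Eh] := complex_frame_vecE hrank hpos frameE frameMD
    (pair_pictures1 q Y) (pair_pictures2 q Y) mY.
  pose u := pair_pictures p X; pose v := pair_pictures q Y.
  have : reval (\sum_t c t *: basis_octic A L t) (col_mx u v) = 0.
    by apply: (product_ideal_eval (A := A)) => // f hf; exact: multiview_cone.
  have -> : reval (\sum_t c t *: basis_octic A L t) (col_mx u v) =
      \sum_t rc (c t) * reval (basis_octic A L t) (col_mx u v).
    rewrite -eval_rmorphismE rmorph_sum; apply: eq_bigr => t _.
    exact: reval_scale.
  pose E pq ss := rc (c (pq, ss)) * reval (basis_octic A L (pq, ss)) (col_mx u v).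
  have -> : \sum_t rc (c t) * reval (basis_octic A L t) (col_mx u v) =
      \sum_pq \sum_ss E pq ss.
    by rewrite pair_bigA; apply: eq_bigr => -[].
  rewrite (bigD1 (p, q)) //= [X in _ + X]big1 ?addr0 => [|[p' q'] pq']; last first.
    apply: big1 => ss _; rewrite /E basis_octic_eval /=.
    have [pp|np] := eqVneq p' p; last by rewrite pair_pictures_other // Tform0 mulr0.
    have nq : q' != q by apply: contraNneq pq' => ->; rewrite pp.
    by rewrite Tform_swap pair_pictures_other // Tform0 mulr0.
  have -> : \sum_ss E (p, q) ss =
      g ^+ 2 * h ^+ 2 * Qform X Y * F (perp_coord p X) (perp_coord q Y).
    transitivity (\sum_t1 \sum_t2 E (p, q) (t1, t2)).
      by rewrite pair_bigA; apply: eq_bigr => -[].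
    rewrite /F mulr_sumr; apply: eq_bigr => t1 _; rewrite mulr_suml mulr_sumr; apply: eq_bigr => t2 _.
    rewrite /E basis_octic_eval /= !Eg !Eh Tform_scale4 ?pnatr_eq0 //.
    by rewrite /sq /d /perp_coord; ring.
  have nz : g ^+ 2 * h ^+ 2 * Qform X Y != 0 by rewrite !mulf_neq0 ?expf_neq0.
  by move/eqP; rewrite mulf_eq0 (negPf nz) => /eqP.
(* Q is not identically zero, so vanishing off the quadric extends to all X and Y. *)
have F0 X Y : F (perp_coord p X) (perp_coord q Y) = 0.
  pose vec (x : 'I_(4 + 4) -> C) : 'cV_(4 + 4) := \col_k x k.
  pose pt (X Y : 'cV[C]_4) : 'I_(4 + 4) -> C := fun k => col_mx X Y k 0.
  have vecK X' Y' : vec (pt X' Y') = col_mx X' Y' by apply/colP => k; rewrite mxE.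
  have pu : polymx (fun x => usubmx (vec x)).
    by move=> k l; apply: polyfun_ext (polyfun_var _ (lshift 4 k)) => x; rewrite !mxE.
  have pd : polymx (fun x => dsubmx (vec x)).
    by move=> k l; apply: polyfun_ext (polyfun_var _ (rshift 4 k)) => x; rewrite !mxE.
  rewrite -{1}(col_mxKu X Y) -{2}(col_mxKd X Y) -vecK.
  apply: (polyfun_generic (@complex_uncountable R)
    (f := fun x => F (perp_coord p (usubmx (vec x))) (perp_coord q (dsubmx (vec x))))
    (g := fun x => Qform (usubmx (vec x)) (dsubmx (vec x)))).
  - apply: polyfun_sum => t1; apply: polyfunM.
      apply: polyfun_sum => t2; apply: polyfunM; first exact: polyfun_cst.
      by apply: polyfunM; exact: polyfun_perp_coord.
    by apply: polyfunM; exact: polyfun_perp_coord.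
  - split; first exact: polyfun_Qform.
    have [|Y' QY] := @Qform_real_nondeg R 1 (const_mx 1).
      rewrite scale1r map_mx_eq0; apply/eqP => /matrixP/(_ 0 0).
      by rewrite !mxE => /eqP; rewrite oner_eq0.
    by exists (pt (1 *: map_mx rc (const_mx 1)) Y'); rewrite vecK col_mxKu col_mxKd.
  - by move=> x; exact: FQ.
have {}F0 a b : F a b = 0.
  have [X EX] := perp_coord_surj p a; have [Y EY] := perp_coord_surj q b.
  rewrite -(F0 X Y) /F; apply: eq_bigr => t1 _; rewrite /sq !EX; congr (_ * _).
  by apply: eq_bigr => t2 _; rewrite !EY.
have dz b t1 : \sum_t2 d t1 t2 * sq b t2 = 0.
  by apply: (quadratic_forms_free (d := fun t1 => \sum_t2 d t1 t2 * sq b t2)) => a; exact: F0.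
have : d s1 s2 = 0 by apply: (quadratic_forms_free (d := d s1)) => b; exact: dz.
by move=> E; apply: (@complexI R); rewrite rmorph0.
Qed.

End OcticIndependence.

(** A vector killed by both cameras is 0, by [picture_inj2]. *)
Lemma rank_pair_left (R : realType) n (A : 'I_n -> 'M[R]_(3, 4))
    (p : {x : 'I_n * 'I_n | (x.1 < x.2)%N}) :
  (forall i, \rank (A i) = 3%N) -> general_position A -> \rank (pair_left A p) = 4%N.
Proof.
move=> hrank hpos; rewrite -mxrank_tr; apply/eqP; apply: inj_row_free => x xD.
pose X := map_mx (real_complex R) x^T.
have DX : map_mx (real_complex R) (pair_left A p) *m X = 0.
  by rewrite -map_mxM -[pair_left A p]trmxK -trmx_mul xD trmx0 map_mx0.
rewrite mul_pair_left in DX.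
have {}DX : col_mx (picture A (val p).1 X)^T (picture A (val p).2 X)^T
    = col_mx 0 0 :> 'M_(3 + 3, 1) by rewrite col_mx0; exact: DX.
have [/(congr1 trmx) + /(congr1 trmx)] := eq_col_mx DX.
rewrite !trmxK !trmx0 => E1 E2.
have /eqP := picture_inj2 hrank hpos (pair_neq p) E1 E2.
by rewrite map_mx_eq0 => /eqP/(congr1 trmx); rewrite trmxK trmx0.
Qed.

Lemma octic_span_dim (R : realType) n (A : 'I_n -> 'M[R]_(3, 4)) :
  (2 <= n)%N -> (forall i, \rank (A i) = 3%N) -> general_position A ->
  span_dim_mod (product_ideal A) (is_octic A) (9 * 'C(n, 2) ^ 2).
Proof.
move=> hn hrank hpos.
have /choice[L /choice[M /choice[D' frame]]] := fun p => left_frame (rank_pair_left p hrank hpos).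
have frameE p := let: And3 h _ _ := frame p in h.
have frameMD p := let: And3 _ h _ := frame p in h.
have frameML p := let: And3 _ _ h := frame p in h.
apply: (span_dim_mod_fintype (b := basis_octic A L)).
- by rewrite !card_prod card_camera_pair !card_ord mulnC mulnn.
- exact: basis_octic_span.
- exact: (basis_octic_free hn hrank hpos frameE frameMD frameML).
- exact: (octic_mod_basis frameE).
Qed.

Theorem theorem7 (R : realType) (n : nat) (A : 'I_n -> 'M[R]_(3, 4))
    (hn : (2 <= n)%N)
    (hrank : forall i, \rank (A i) = 3%N)
    (hpos : general_position A) :
  [/\ (* set-theoretic equality in (P^2)^n x (P^2)^n *)
      forall u v : 'M[R[i]]_(n, 3),
        zero_locus (rigid_ideal A) (col_mx u v) <->
        [/\ multiview_variety A u, multiview_variety A v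
          & forall p, is_octic A p -> reval p (col_mx u v) = 0],
      (* number of octic generators *)
      span_dim_mod (product_ideal A) (is_octic A) (9 * 'C(n, 2) ^ 2)
    & (* radical of H_A + I_A(u) + I_A(v) *)
      forall p,
        ideal_radical (ideal_add (octic_ideal A) (product_ideal A)) p <->
        rigid_ideal A p].
Proof.
split.
- exact: zero_locus_rigid.
- exact: octic_span_dim.
- exact: radical_rigid.
Qed.
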